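(* Let $T$ be a tomographically local GPT and let $sT$ be a swirled version of $T$. A causal structure admits of an $sT$-$T$ gap if and only if at least one of its districts admits of an $sT$-$T$ gap.
   Context: GPT. A tomographically local GPT $T$ consists of a collection of systems closed under composition (with a trivial system); each system $S$ has a finite-dimensional real vector space $V_S$, with $V_{AB}=V_A\otimes V_B$ and $V_{\rm trivial}=\mathbb{R}$. For each pair $A,B$ there is a convex set of linear maps $V_A\to V_B$, the (valid) transformations; states are the transformations from the trivial system and effects those to the trivial system. States span $V_S$ and effects span its dual. Transformations contain identities and swaps and are closed under sequential and parallel composition; every closed circuit evaluates to a number in $[0,1]$. Each system has a unit effect $u_S$ with $u_{AB}=u_A\otimes u_B$; a transformation $\mathcal{E}:A\to B$ is deterministic if $u_B\circ\mathcal{E}=u_A$. $T$ contains classical probability theory (CPT): for each finite set $X$ there is a classical system with $V=\mathbb{R}^X$, transformations between classical systems being exactly the substochastic matrices (deterministic: stochastic matrices), and transformations can be conditioned on classical systems. Swirling. A symmetry of $T$ is a finite group $G$ with, for each system $S$, a representation $g\mapsto\mathcal{F}^S_g$ by invertible linear maps on $V_S$, acting collectively on composites ($\mathcal{F}^{AB}_g=\mathcal{F}^A_g\otimes\mathcal{F}^B_g$), trivially on classical systems, preserving the sets of states and of effects and the unit effect, and mapping transformations to transformations by conjugation. It is nonphysical if some $\mathcal{F}^S_g$ is not a valid transformation of $T$. The swirled theory $sT$ for a nonphysical symmetry is the subtheory of $T$ with all and only the invariant states and effects and all and only the covariant transformations ($\mathcal{E}\circ\mathcal{F}^A_g=\mathcal{F}^B_g\circ\mathcal{E}$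 for all $g$). Causal structures. A causal structure (with unrestricted gates) is a finite directed acyclic circuit shape consisting of gates connected by wires. Each wire is either latent (stipulated to be a GPT wire or a classical wire) or an observed classical variable. Each observed variable is either an open input or the output of exactly one gate; it may be copied and fed to any number of gates (acyclically), and each observed variable output by a gate is an open output. Each latent wire is the output of exactly one gate and the input of exactly one gate. For open inputs $\mathbf{I}$ and open outputs $\mathbf{O}$ with finite alphabets, $P(\mathbf{O}|\mathbf{I})$ is $T$-realizable in the causal structure if one can assign systems of $T$ to latent GPT wires, finite classical systems to latent classical wires, and deterministic transformations of $T$ to gates so that the circuit yields $P(\mathbf{O}|\mathbf{I})$; likewise for $sT$. The causal structure admits of an $sT$-$T$ gap if the set of $T$-realizable distributions is a strict superset of the set of $sT$-realizable distributions (for some choice of finite alphabets). Districts. Cut all observed classical wires (but no latent wire, even a classical one) and identify the connected fragments of the circuit; then reconnect, within each fragment, all observed classical wires that run within the fragment. Each resulting fragment is a district. Equivalently, a district consists of the gates in one connected component of the graph in which two gates are adjacent when joined by a latent wire, together with the latent wires between them; its open outputs are the observed variables output by its gates, and its open inputs are the observed variables fed to its gates but not output by any of its gates (each such variable counted once). A district is itself a causal structure. *)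

(* Defs.v *)
From HB Require Import structures.
From mathcomp Require Import all_boot all_order all_algebra all_fingroup.
From mathcomp Require Import boolp reals.

Set Implicit Arguments.
Unset Strict Implicit.
Unset Printing Implicit Defensive.

Import Order.TTheory GRing.Theory Num.Theory.
Local Open Scope ring_scope.

(* [W], with [t] as the map (u, v) |-> u (x) v, is the tensor product of [U]
   and [V]: the universal property. *)
Definition tensor_product (R : realType) (U V W : vectType R)
    (t : U -> V -> W) : Prop :=
  bilinear_for *:%R *:%R t /\
  forall (Z : vectType R) (f : U -> V -> Z), bilinear_for *:%R *:%R f ->
    exists! h : 'Hom(W, Z), forall u v, h (t u v) = f u v.

(* The purely linear part of a GPT.  [V_trivial = R] and [V_(cls X) = R^X] are
   given by explicit linear isomorphisms [scal] and [clsR], and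
   [V_AB = V_A (x) V_B] by the map [tens]; composition of systems is associative
   and unital only up to the canonical isomorphisms of tensor products. *)
Record systems (R : realType) := Systems {
  sys :> Type;
  V : sys -> vectType R;
  triv : sys;
  scal : 'Hom(V triv, R^o);
  scal_bij : bijective scal;
  comp : sys -> sys -> sys;
  tens : forall A B, V A -> V B -> V (comp A B);
  tensP : forall A B, tensor_product (@tens A B);
  cls : finType -> sys;
  clsR : forall X : finType, 'Hom(V (cls X), {ffun X -> R^o});
  clsR_bij : forall X : finType, bijective (clsR X)
}.

Arguments V {R s}.
Arguments triv {R s}.
Arguments scal {R s}.
Arguments comp {R s}.
Arguments tens {R s A B}.
Arguments cls {R s}.
Arguments clsR {R s}.

Section Systems.
Variables (R : realType) (S : systems R).
Implicit Types A B : S.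

(* The number 1 in V_trivial = R. *)
Definition one : V (triv : S) := (scal^-1)%VF 1.

(* The point distribution at [x], the basis vector of V_(cls X) = R^X. *)
Definition pt (X : finType) (x : X) : V (cls X : S) :=
  ((clsR X)^-1)%VF [ffun y => (y == x)%:R].

(* The matrix entry E(y|x) of a linear map between classical systems. *)
Definition cls_mx (X Y : finType) (E : 'Hom(V (cls X : S), V (cls Y : S)))
    (y : Y) (x : X) : R :=
  clsR Y (E (pt x)) y.

Definition substochastic (X Y : finType)
    (E : 'Hom(V (cls X : S), V (cls Y : S))) : Prop :=
  (forall x y, 0 <= cls_mx E y x) /\
  (forall x, \sum_(y : Y) cls_mx E y x <= 1).

Lemma cotens_subproof A B (f : 'Hom(V A, R^o)) (g : 'Hom(V B, R^o)) :
  exists h : 'Hom(V (comp A B), R^o),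
    forall a b, h (tens a b) = f a * g b.
Proof.
have bil : bilinear_for *:%R *:%R (fun a b => f a * g b : R^o).
  split=> [u'|u] c x y /=.
    by rewrite linearP mulrDl scalerAl.
  by rewrite linearP mulrDr scalerAr.
by have [h [hE _]] := (tensP A B).2 _ _ bil; exists h.
Qed.

(* f (x) g : V_A (x) V_B -> R. *)
Definition cotens A B (f : 'Hom(V A, R^o)) (g : 'Hom(V B, R^o)) :
    'Hom(V (comp A B), R^o) :=
  sval (cid (cotens_subproof f g)).

Lemma cotensE A B (f : 'Hom(V A, R^o)) (g : 'Hom(V B, R^o)) a b :
  cotens f g (tens a b) = f a * g b.
Proof. exact: (svalP (cid (cotens_subproof f g)) a b). Qed.

Section Families.
Variables (W : Type) (ws : W -> S).

(* The composite of the systems carried by a list of wires. *)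
Fixpoint comps (s : seq W) : S :=
  if s is w :: s' then comp (ws w) (comps s') else triv.

Fixpoint tprod (f : forall w, V (ws w)) (s : seq W) : V (comps s) :=
  if s is w :: s' then tens (f w) (tprod f s') else one.

Fixpoint cotprod (f : forall w, 'Hom(V (ws w), R^o)) (s : seq W) :
    'Hom(V (comps s), R^o) :=
  if s is w :: s' then cotens (f w) (cotprod f s') else scal.

End Families.
End Systems.

Arguments one {R S}.
Arguments pt {R S X}.

Definition is_state (R : realType) (S : systems R)
    (K : forall A B : S, 'Hom(V A, V B) -> Prop) (A : S) (v : V A) : Prop :=
  exists2 E, K triv A E & v = E one.

(* A tomographically local GPT.  The closure conditions below are all of the
   form "every linear map acting on product vectors in such and such a way is a
   transformation"; by the universal property of [tens] there is exactly one
   such map. *)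
Record gpt (R : realType) := Gpt {
  gsys :> systems R;
  trans : forall A B : gsys, 'Hom(V A, V B) -> Prop;
  trans_convex : forall (A B : gsys) (E F : 'Hom(V A, V B)) (p : R),
    0 <= p <= 1 -> trans E -> trans F -> trans (p *: E + (1 - p) *: F);
  states_span : forall A : gsys, exists2 s : seq (V A),
    (forall v, v \in s -> is_state trans v) & <<s>>%VS = fullv;
  effects_span : forall A : gsys, exists2 s : seq 'Hom(V A, V (triv : gsys)),
    (forall e, e \in s -> trans e) & <<s>>%VS = fullv;
  trans_id : forall A : gsys, trans (\1%VF : 'Hom(V A, V A));
  trans_comp : forall (A B C : gsys) (E : 'Hom(V A, V B)) (F : 'Hom(V B, V C)),
    trans E -> trans F -> trans (F \o E)%VF;
  trans_tens : forall (A A' B B' : gsys) (E : 'Hom(V A, V A'))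
      (F : 'Hom(V B, V B')) (H : 'Hom(V (comp A B), V (comp A' B'))),
    trans E -> trans F ->
    (forall a b, H (tens a b) = tens (E a) (F b)) -> trans H;
  trans_swap : forall (A B : gsys) (H : 'Hom(V (comp A B), V (comp B A))),
    (forall a b, H (tens a b) = tens b a) -> trans H;
  (* [A (BC)] and [(AB) C], and likewise [trivial A] and [A], are the same
     system: the canonical identifications are transformations *)
  trans_assoc : forall (A B C : gsys)
      (H : 'Hom(V (comp (comp A B) C), V (comp A (comp B C)))),
    (forall a b c, H (tens (tens a b) c) = tens a (tens b c)) -> trans H;
  trans_assoc_inv : forall (A B C : gsys)
      (H : 'Hom(V (comp A (comp B C)), V (comp (comp A B) C))),
    (forall a b c, H (tens a (tens b c)) = tens (tens a b) c) -> trans H;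
  trans_unitl : forall (A : gsys) (H : 'Hom(V (comp triv A), V A)),
    (forall a, H (tens one a) = a) -> trans H;
  trans_unitl_inv : forall (A : gsys) (H : 'Hom(V A, V (comp triv A))),
    (forall a, H a = tens one a) -> trans H;
  trans_closed : forall E : 'Hom(V (triv : gsys), V (triv : gsys)), trans E ->
    0 <= (scal (E one) : R) <= 1;
  unit_eff : forall A : gsys, 'Hom(V A, V (triv : gsys));
  unit_eff_trans : forall A, trans (unit_eff A);
  unit_eff_comp : forall (A B : gsys) (a : V A) (b : V B),
    scal (unit_eff (comp A B) (tens a b)) =
    (scal (unit_eff A a) : R) * scal (unit_eff B b);
  unit_eff_triv : unit_eff triv = \1%VF;
  (* classical probability theory: transformations between classical systems
     are the substochastic matrices, the deterministic ones the stochastic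
     matrices (as the classical unit effect is summation), and the composite of
     the classical systems X and Y is the classical system X * Y *)
  trans_cls : forall (X Y : finType) (E : 'Hom(V (cls X : gsys), V (cls Y))),
    trans E <-> substochastic E;
  unit_eff_cls : forall (X : finType) (v : V (cls X : gsys)),
    scal (unit_eff (cls X) v) = \sum_(x : X) (clsR X v x : R);
  trans_cls_comp : forall (X Y : finType)
      (H : 'Hom(V (comp (cls X : gsys) (cls Y)), V (cls (X * Y)%type))),
    (forall x y, H (tens (pt x) (pt y)) = pt (x, y)) -> trans H;
  trans_cls_comp_inv : forall (X Y : finType)
      (H : 'Hom(V (cls (X * Y)%type), V (comp (cls X : gsys) (cls Y)))),
    (forall x y, H (pt (x, y)) = tens (pt x) (pt y)) -> trans H;
  trans_cls_triv : forall H : 'Hom(V (cls unit), V (triv : gsys)),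
    H (pt tt) = one -> trans H;
  trans_cls_triv_inv : forall H : 'Hom(V (triv : gsys), V (cls unit)),
    H one = pt tt -> trans H;
  (* conditioning of transformations on a classical system *)
  trans_cond : forall (X : finType) (A B : gsys) (E : X -> 'Hom(V A, V B))
      (H : 'Hom(V (comp (cls X) A), V B)),
    (forall x, trans (E x)) ->
    (forall x a, H (tens (pt x) a) = E x a) -> trans H
}.

Arguments trans {R} g [A B].
Arguments unit_eff {R g}.

Definition deterministic (R : realType) (T : gpt R) (A B : T)
    (E : 'Hom(V A, V B)) : Prop :=
  (unit_eff B \o E)%VF = unit_eff A.

Record symmetry (R : realType) (T : gpt R) (G : finGroupType) := Symmetry {
  rep : forall A : T, G -> 'Hom(V A, V A);
  rep1 : forall A, rep A 1%g = \1%VF;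
  repM : forall A g h, rep A (g * h)%g = (rep A g \o rep A h)%VF;
  rep_comp : forall (A B : T) g (a : V A) (b : V B),
    rep (comp A B) g (tens a b) = tens (rep A g a) (rep B g b);
  rep_cls : forall (X : finType) g, rep (cls X) g = \1%VF;
  rep_state : forall (A : T) g (v : V A),
    is_state (@trans R T) v -> is_state (@trans R T) (rep A g v);
  rep_effect : forall (A : T) g (e : 'Hom(V A, V triv)),
    trans T e -> trans T (e \o rep A g)%VF;
  rep_unit : forall A g, (unit_eff A \o rep A g)%VF = unit_eff A;
  rep_conj : forall (A B : T) g (E : 'Hom(V A, V B)),
    trans T E -> trans T (rep B g \o E \o rep A g^-1%g)%VF
}.

Definition nonphysical (R : realType) (T : gpt R) (G : finGroupType)
    (F : symmetry T G) : Prop :=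
  exists (A : T) (g : G), ~ trans T (rep F A g).

(* The transformations of the swirled theory sT; its systems are those of T.
   Invariance of states and effects is the case of a trivial source or target:
   [swirled_state], [swirled_effect]. *)
Definition swirled (R : realType) (T : gpt R) (G : finGroupType)
    (F : symmetry T G) (A B : T) (E : 'Hom(V A, V B)) : Prop :=
  trans T E /\ forall g, (E \o rep F A g)%VF = (rep F B g \o E)%VF.

Section SwirledStates.
Variables (R : realType) (T : gpt R) (G : finGroupType) (F : symmetry T G).

Lemma rep_triv g : rep F triv g = \1%VF.
Proof. by have := rep_unit F triv g; rewrite unit_eff_triv comp_lfun1l. Qed.

Lemma oneP (v : V (triv : T)) : v = (scal v : R) *: one.
Proof.
have inj : injective (scal : V (triv : T) -> R^o) by apply: bij_inj (scal_bij T).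
have [k _ scalK] := scal_bij T.
have scal1 : (scal (one : V (triv : T)) : R^o) = 1.
  apply: limg_lfunVK; apply/memv_imgP.
  by exists (k 1); rewrite ?memvf ?scalK.
apply: inj; rewrite linearZ.
by rewrite /= scal1 -[in LHS](mulr1 (scal v)).
Qed.

Lemma swirled_state (A : T) (E : 'Hom(V triv, V A)) :
  swirled F E <-> trans T E /\ forall g, rep F A g (E one) = E one.
Proof.
split=> -[tE cE]; split=> // g.
  by have := congr1 (fun H : 'Hom(_, _) => H one) (cE g);
     rewrite !comp_lfunE rep_triv id_lfunE.
rewrite rep_triv comp_lfun1r; apply/lfunP=> v.
by rewrite comp_lfunE (oneP v) !linearZ /= cE.
Qed.

Lemma swirled_effect (A : T) (e : 'Hom(V A, V triv)) :
  swirled F e <-> trans T e /\ forall g, (e \o rep F A g)%VF = e.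
Proof.
by split=> -[te ce]; split=> // g; have := ce g;
   rewrite rep_triv comp_lfun1l.
Qed.

End SwirledStates.

(* [ofed v] is the set of gates to which (a copy of) the observed variable [v]
   is fed; [osrc v = None] says that [v] is an open input, [osrc v = Some g]
   that it is output by [g], hence an open output. *)
Record circuit_shape := CircuitShape {
  gate : finType;
  latent : finType;
  lat_cls : pred latent;
  lsrc : latent -> gate;
  ltgt : latent -> gate;
  obs : finType;
  osrc : obs -> option gate;
  ofed : obs -> {set gate}
}.

Definition wire (C : circuit_shape) : finType := (latent C + obs C)%type.

Definition wsrc (C : circuit_shape) (w : wire C) : option (gate C) :=
  match w with inl l => Some (lsrc l) | inr v => osrc v end.

Definition wfed (C : circuit_shape) (w : wire C) (g : gate C) : bool :=
  match w with inl l => ltgt l == g | inr v => g \in ofed v end.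

Definition gate_edge (C : circuit_shape) : rel (gate C) :=
  fun g h => [exists w : wire C, (wsrc w == Some g) && wfed w h].

Definition acyclic (C : circuit_shape) : Prop :=
  forall g h : gate C, gate_edge g h -> ~~ connect (@gate_edge C) h g.

Record causal_structure := CausalStructure {
  shape :> circuit_shape;
  shape_acyclic : acyclic shape
}.

Definition win (C : circuit_shape) (g : gate C) : seq (wire C) :=
  [seq w <- enum (wire C) | wfed w g].

Definition wout (C : circuit_shape) (g : gate C) : seq (wire C) :=
  [seq w <- enum (wire C) | wsrc w == Some g].

Section Realizability.
Variables (R : realType) (T : gpt R) (C : causal_structure).
Variables (al : obs C -> finType) (lsys : latent C -> T).

Definition wsys (w : wire C) : T :=
  match w with inl l => lsys l | inr v => cls (al v) end.

(* The basis vector of a wire, and the dual one: for a latent wire [l] those of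
   index [k l], for an observed variable [v] those of the value [x v]. *)
Definition wvec (k : forall l, 'I_(\dim {: V (lsys l)}))
    (x : forall v, al v) (w : wire C) : V (wsys w) :=
  match w return V (wsys w) with
  | inl l => (vbasis {: V (lsys l)})`_(k l)
  | inr v => pt (x v)
  end.

Definition wcovec (k : forall l, 'I_(\dim {: V (lsys l)}))
    (x : forall v, al v) (w : wire C) : 'Hom(V (wsys w), R^o) :=
  match w return 'Hom(V (wsys w), R^o) with
  | inl l => linfun (coord (vbasis {: V (lsys l)}) (k l) : _ -> R^o)
  | inr v => linfun (fun y => clsR (al v) y (x v) : R^o)
  end.

(* The number P(o|i) yielded by the circuit with transformations [E g] at its
   gates, where [x] is the joint value (o, i) of all observed variables: the
   tensor network contraction, in which every latent wire is expanded in a basis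
   and its dual basis, and every (copy of an) observed variable [v] is set to
   [x v]. *)
Definition circuit_value
    (E : forall g : gate C,
       'Hom(V (comps wsys (win g)), V (comps wsys (wout g))))
    (x : {dffun forall v : obs C, al v}) : R :=
  \sum_(k : {dffun forall l : latent C, 'I_(\dim {: V (lsys l)})})
    \prod_(g : gate C)
      cotprod (wcovec k x) (wout g) (E g (tprod (wvec k x) (win g))).

End Realizability.

Arguments circuit_value {R T C al lsys}.

(* Realizability of the conditional distribution [P] (a function of the joint
   value of open inputs and open outputs) with the transformations of the
   subtheory [K] of [T]. *)
Definition realizable (R : realType) (T : gpt R)
    (K : forall A B : T, 'Hom(V A, V B) -> Prop) (C : causal_structure)
    (al : obs C -> finType) (P : {dffun forall v : obs C, al v} -> R) : Prop :=
  exists (lsys : latent C -> T)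
    (E : forall g : gate C, 'Hom(V (comps (wsys al lsys) (win g)),
                                 V (comps (wsys al lsys) (wout g)))),
  [/\ forall l, lat_cls l -> exists X : finType, lsys l = cls X,
      forall g, K _ _ (E g) /\ deterministic (E g)
    & forall x, circuit_value E x = P x].

(* Alphabets are required to be nonempty: a distribution over an empty alphabet is
   meaningless. *)
Definition admits_gap (R : realType) (T : gpt R) (G : finGroupType)
    (F : symmetry T G) (C : causal_structure) : Prop :=
  exists2 al : obs C -> finType, (forall v, inhabited (al v)) &
    (forall P : {dffun forall v : obs C, al v} -> R,
       realizable (@swirled R T G F) P -> realizable (@trans R T) P) /\
    (exists2 P : {dffun forall v : obs C, al v} -> R,
       realizable (@trans R T) P & ~ realizable (@swirled R T G F) P).

Definition latent_adj (C : circuit_shape) : rel (gate C) :=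
  fun g h => [exists l : latent C,
    ((lsrc l == g) && (ltgt l == h)) || ((lsrc l == h) && (ltgt l == g))].

Section District.
Variables (C : causal_structure) (g0 : gate C).

Definition in_district : pred (gate C) :=
  fun g => connect (@latent_adj C) g0 g.

Definition dgate : finType := {g : gate C | in_district g}.

Definition dlatent : finType := {l : latent C | in_district (lsrc l)}.

Definition dobs : finType :=
  {v : obs C | (if osrc v is Some g then in_district g else false)
               || [exists g, in_district g && (g \in ofed v)]}.

Lemma dtgt_subproof (l : dlatent) : in_district (ltgt (val l)).
Proof.
apply: connect_trans (valP l) (connect1 _).
by apply/existsP; exists (val l); rewrite !eqxx.
Qed.

Definition district_shape : circuit_shape :=
  @CircuitShape dgate dlatent (fun l => lat_cls (val l))
    (fun l => Sub (lsrc (val l)) (valP l))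
    (fun l => Sub (ltgt (val l)) (dtgt_subproof l))
    dobs
    (fun v => obind insub (osrc (val v)))
    (fun v => [set g : dgate | val g \in ofed (val v)]).

Lemma district_edge (g h : gate district_shape) :
  gate_edge g h -> gate_edge (val g : gate C) (val h).
Proof.
case/existsP=> -[l|v] /andP[/= /eqP e f]; apply/existsP.
  exists (inl (val l)) => /=; case: e => <-; rewrite eqxx /=.
  by rewrite -(eqP f).
exists (inr (val v)) => /=; rewrite inE in f; rewrite f andbT.
case: (osrc (val v)) e => //= g'; case: insubP => //= u _ uE [<-].
by rewrite uE.
Qed.

Lemma district_acyclic : acyclic district_shape.
Proof.
move=> g h gh; apply: contra (shape_acyclic (district_edge gh)).
case/connectP=> p; elim: p h {gh} => [|k p IHp] h /=; first by move=> _ ->.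
case/andP=> hk kp lastp.
exact: connect_trans (connect1 (district_edge hk)) (IHp _ kp lastp).
Qed.

(* The district containing the gate [g0]; every district is of this form. *)
Definition district : causal_structure := CausalStructure district_acyclic.

End District.

(* Main.v *)
From HB Require Import structures.
From mathcomp Require Import all_boot all_order all_algebra all_fingroup.
From mathcomp Require Import boolp reals ring.
Require Import Defs.

(* A circuit factors over its districts: only latent wires are summed over, and
   no latent wire joins two districts.  Conversely, models of the districts glue
   to a model of the whole circuit, so if no district has a gap, then the swirled
   models of the districts glue to a swirled model of any T-realizable P.

   For the other direction let a district D realize A in T but not in sT.  Let
   all gates outside D prepare uniform states, which gives a factor A' > 0, so
   that Q = A A' is T-realizable.  Suppose that a swirled circuit realizes
   Q = B B', where B is the factor of D.  The mixed products A B' and B A' are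
   also values of circuits of T, hence nonnegative and, for fixed open inputs,
   of total mass 1, as is Q.  Since (A B') (B A') = Q^2, the inequality of
   arithmetic and geometric means forces A B' = B A' = Q = A A', so B = A, and A
   would be realized by the swirled model of D. *)

Set Implicit Arguments.
Unset Strict Implicit.
Unset Printing Implicit Defensive.

Import Order.TTheory GRing.Theory Num.Theory.
Local Open Scope ring_scope.

(** * Finite sums and products over dependent families *)

Section DependentSums.
Variables (I : finType) (T : I -> finType).
Implicit Types (f z : {dffun forall i, T i}) (W : pred I).

(** Summing over all [z'] with [agree W z z'] is summing over the coordinates in [W] with the others
    frozen at [z]; no functions on varying domains are needed. *)
Definition agree W z z' : bool := [forall i, W i || (z i == z' i)].

Lemma agreeP W z z' : reflect (forall i, ~~ W i -> z i = z' i) (agree W z z').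
Proof.
apply: (iffP forallP) => [h i Wi|h i].
  by have := h i; rewrite (negPf Wi) => /eqP.
by case: (boolP (W i)) => //= Wi; rewrite h.
Qed.

Lemma agree_refl W z : agree W z z.
Proof. by apply/agreeP. Qed.

Definition splice W z z' : {dffun forall i, T i} :=
  [ffun i => if W i then z' i else z i].

Lemma spliceE W z z' i : splice W z z' i = if W i then z' i else z i.
Proof. exact: ffunE. Qed.

Lemma eq_agree W W' z : W =1 W' -> agree W z =1 agree W' z.
Proof. by move=> e z'; apply: eq_forallb => i; rewrite e. Qed.

Lemma agree0 (W : pred I) z z' : (forall i, ~~ W i) -> agree W z z' = (z' == z).
Proof.
move=> W0; apply/agreeP/eqP => [h|-> //].
by apply/ffunP => i; rewrite h.
Qed.

(** Fubini for disjoint sets of coordinates: the intermediate point [z1] is [z'] with its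
    coordinates outside [W1] reset to those of [z]. *)
Lemma agree_nested (M : nmodType) W1 W2 z (F : {dffun forall i, T i} -> M) :
  (forall i, W1 i -> ~~ W2 i) ->
  \sum_(z' | agree (predU W1 W2) z z') F z' =
  \sum_(z1 | agree W1 z z1) \sum_(z' | agree W2 z1 z') F z'.
Proof.
move=> W12.
rewrite (partition_big (splice W1 z) (agree W1 z)) /=; last first.
  move=> z' _; apply/agreeP => i Wi; by rewrite spliceE (negPf Wi).
apply: eq_bigr => z1 /agreeP h1; apply: eq_bigl => z'.
apply/andP/agreeP => [[/agreeP h /eqP <-] i Wi|h].
  by rewrite spliceE; case: ifP => // Wi'; apply: h; rewrite /= Wi' (negPf Wi).
split.
  by apply/agreeP => i /norP[Wi Wi']; rewrite h1 // h.
apply/eqP/ffunP => i; rewrite spliceE; case: ifP => Wi; last by rewrite h1 ?Wi.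
by rewrite h // W12.
Qed.

Definition set1f z (i : I) (t : T i) : {dffun forall i, T i} :=
  [ffun j => if pselect (i = j) is left e then ecast j (T j) e t else z j].

Lemma set1f_eq z i t : @set1f z i t i = t.
Proof.
rewrite ffunE; case: pselect => // e.
by rewrite (Prop_irrelevance e erefl).
Qed.

Lemma set1f_neq z i t j : i != j -> @set1f z i t j = z j.
Proof. by rewrite ffunE; case: pselect => // e /eqP. Qed.

Lemma agree_pred1 (M : nmodType) z i (F : {dffun forall i, T i} -> M) :
  \sum_(z' | agree (pred1 i) z z') F z' = \sum_(t : T i) F (set1f z t).
Proof.
rewrite (reindex_onto (@set1f z i) (fun z' => z' i)) /=.
  apply: eq_bigl => t; rewrite set1f_eq eqxx andbT.
  by apply/agreeP => j /= ji; rewrite set1f_neq // eq_sym.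
move=> z' /agreeP h; apply/ffunP => j.
by have [<-|ij] := eqVneq i j; rewrite ?set1f_eq // set1f_neq // h //= eq_sym.
Qed.

End DependentSums.

(** Each inner sum is rewritten as a sum over tagged values with tag [i], so that distributivity for
    a constant index type applies. *)
Lemma big_distr_dffun (R : comPzSemiRingType) (I : finType) (T : I -> finType)
    (F : forall i, T i -> R) :
  \prod_i \sum_(t : T i) F i t =
  \sum_(f : {dffun forall i, T i}) \prod_i F i (f i).
Proof.
pose P i : {ffun T i -> R} := [ffun t => F i t].
transitivity (\prod_i \sum_(t : T i) P i t).
  by apply: eq_bigr => i _; apply: eq_bigr => t _; rewrite ffunE.
rewrite (eq_bigr _ (fun i _ => big_tag (fun i => P i : T i -> R) i)).
rewrite bigA_distr_big_dep -big_fprod.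
rewrite (reindex (@fprod_of_dffun _ T)) /=; last first.
  exact/onW_bij/fprod_of_dffun_bij.
apply: eq_bigr => f _; apply: eq_big => // i _.
by rewrite ffunE -[in RHS](fprod_of_dffunK f) ffunE.
Qed.

(* [part i] is the only factor that depends on the coordinate [i]. *)
Lemma big_distr_blocks (R : comPzSemiRingType) (I J : finType) (T : I -> finType)
    (p : J -> pred I) (part : I -> J) (pP : forall j i, p j i = (j == part i))
    (a : forall j, {dffun forall d : {i | p j i}, T (val d)} -> R) :
  \sum_(k : {dffun forall i, T i}) \prod_j a j [ffun d => k (val d)] =
  \prod_j \sum_(k : {dffun forall d : {i | p j i}, T (val d)}) a j k.
Proof.
pose B j : finType := {dffun forall d : {i | p j i}, T (val d)}.
have pp i : p (part i) i by rewrite pP.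
pose h (f : {dffun forall j, B j}) : {dffun forall i, T i} :=
  [ffun i => f (part i) (Sub i (pp i))].
pose r (k : {dffun forall i, T i}) : {dffun forall j, B j} :=
  [ffun j => ([ffun d => k (val d)] : B j)].
rewrite (big_distr_dffun (fun j (k : B j) => a j k)) (reindex r) /=.
  by apply: eq_bigr => k _; apply: eq_bigr => j _; rewrite ffunE.
exists h => [k _|f _].
  by apply/ffunP => i; rewrite /h /r !ffunE.
apply/ffunP => j; apply/ffunP => d; rewrite /r /h ffunE [LHS]ffunE ffunE.
(* The indices [j] and [part (val d)] are equal only provably, so the claim is stated for a variable
   [j'] that can be identified with [j]. *)
have aux j' (e : j = j') (pf : p j' (val d)) : f j' (Sub (val d) pf) = f j d.
  by case: j' / e pf => pf; case: d pf => i pi pf; rewrite (bool_irrelevance pf pi).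
by apply: aux; apply/eqP; rewrite -pP (valP d).
Qed.

(** * Maps defined on product vectors *)

Lemma linear_hom (R : realType) (U Z : vectType R) (f : U -> Z) : linear f ->
  exists H : 'Hom(U, Z), forall u, H u = f u.
Proof.
move=> lin; pose linM := GRing.isLinear.Build _ _ _ _ f lin.
pose F : {linear U -> Z} := HB.pack f linM.
by exists (linfun F) => u; rewrite lfunE.
Qed.

Section Tensor.
Variables (R : realType) (S : systems R).
Implicit Types A B C : S.

Lemma tens_biadd A B :
  bilinear_for *:%R *:%R (@tens R S A B).
Proof. exact: (tensP A B).1. Qed.

Lemma tensPl A B c (a a' : V A) (b : V B) :
  tens (c *: a + a') b = c *: tens a b + tens a' b.
Proof. by have [h _] := tens_biadd A B; exact: h. Qed.

Lemma tensPr A B c (a : V A) (b b' : V B) :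
  tens a (c *: b + b') = c *: tens a b + tens a b'.
Proof. by have [_ h] := tens_biadd A B; exact: h. Qed.

Lemma tensDl A B (a a' : V A) (b : V B) : tens (a + a') b = tens a b + tens a' b.
Proof. by have := tensPl 1 a a' b; rewrite !scale1r. Qed.

Lemma tensZl A B c (a : V A) (b : V B) : tens (c *: a) b = c *: tens a b.
Proof.
have t0 : tens (0 : V A) b = 0.
  by apply: (addrI (tens 0 b)); rewrite addr0 -tensDl addr0.
by have := tensPl c a 0 b; rewrite !addr0 t0 addr0.
Qed.

Lemma tensDr A B (a : V A) (b b' : V B) : tens a (b + b') = tens a b + tens a b'.
Proof. by have := tensPr 1 a b b'; rewrite !scale1r. Qed.

Lemma tensZr A B c (a : V A) (b : V B) : tens a (c *: b) = c *: tens a b.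
Proof.
have t0 : tens a (0 : V B) = 0.
  by apply: (addrI (tens a 0)); rewrite addr0 -tensDr addr0.
by have := tensPr c a b 0; rewrite !addr0 t0 addr0.
Qed.

Lemma tens_suml A B (I : Type) (r : seq I) (P : pred I) (F : I -> V A) (b : V B) :
  tens (\sum_(i <- r | P i) F i) b = \sum_(i <- r | P i) tens (F i) b.
Proof.
apply: (big_morph (fun a => tens a b)) => [a a'|]; first exact: tensDl.
by rewrite -(scale0r 0) tensZl scale0r.
Qed.

Lemma tens_sumr A B (I : Type) (r : seq I) (P : pred I) (a : V A) (F : I -> V B) :
  tens a (\sum_(i <- r | P i) F i) = \sum_(i <- r | P i) tens a (F i).
Proof.
apply: (big_morph (fun b => tens a b)) => [b b'|]; first exact: tensDr.
by rewrite -(scale0r 0) tensZr scale0r.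
Qed.

Lemma tens_ext A B (Z : vectType R) (h h' : 'Hom(V (comp A B), Z)) :
  (forall a b, h (tens a b) = h' (tens a b)) -> h = h'.
Proof.
move=> hh'; have bil : bilinear_for *:%R *:%R (fun (a : V A) (b : V B) => h (tens a b)).
  by split=> [b|a] c u v /=; rewrite ?tensDl ?tensZl ?tensDr ?tensZr linearP.
have [k [_ uniq_k]] := (tensP A B).2 _ _ bil.
by rewrite -(uniq_k h) // -(uniq_k h') // => u v; rewrite hh'.
Qed.

(** An induction principle: an identity linear in [v] need only be checked on product vectors, even
    for functions not bundled as linear maps. *)
Lemma tens_ind A B (Z : vectType R) (f g : V (comp A B) -> Z) :
  linear f -> linear g ->
  (forall a b, f (tens a b) = g (tens a b)) -> forall v, f v = g v.
Proof.
move=> lf lg fg v.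
have [F FE] := linear_hom lf; have [K KE] := linear_hom lg.
have FK : F = K by apply: tens_ext => a b; rewrite FE KE.
by rewrite -FE -KE FK.
Qed.

Lemma tens_lift A B (Z : vectType R) (f : V A -> V B -> Z) :
  bilinear_for *:%R *:%R f ->
  exists h : 'Hom(V (comp A B), Z), forall a b, h (tens a b) = f a b.
Proof. by move=> bf; have [h [hE _]] := (tensP A B).2 _ _ bf; exists h. Qed.

Lemma tens_map_exists A A' B B' (E : 'Hom(V A, V A')) (F : 'Hom(V B, V B')) :
  exists H : 'Hom(V (comp A B), V (comp A' B')),
    forall a b, H (tens a b) = tens (E a) (F b).
Proof.
apply: (@tens_lift _ _ _ (fun a b => tens (E a) (F b))).
by split=> [b|a] c u v /=; rewrite linearP ?tensDl ?tensZl ?tensDr ?tensZr.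
Qed.

Lemma tens_swap_exists A B : exists H : 'Hom(V (comp A B), V (comp B A)),
  forall a b, H (tens a b) = tens b a.
Proof.
apply: (@tens_lift _ _ _ (fun a b => tens b a)).
by split=> [b|a] c u v /=; rewrite ?tensDl ?tensZl ?tensDr ?tensZr.
Qed.

Lemma hom_linear (U W : vectType R) (h : 'Hom(U, W)) c u v :
  h (c *: u + v) = c *: h u + h v.
Proof. exact: linearP. Qed.

(** The universal property is used twice. For fixed [c] it gives a map on [comp A B]; that this map
    depends linearly on [c] is checked on product vectors, so the family lifts again. *)
Lemma tens_assoc_exists A B C :
  exists H : 'Hom(V (comp (comp A B) C), V (comp A (comp B C))),
    forall a b c, H (tens (tens a b) c) = tens a (tens b c).
Proof.
have ex c : exists h : 'Hom(V (comp A B), V (comp A (comp B C))),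
    forall a b, h (tens a b) = tens a (tens b c).
  apply: (@tens_lift _ _ _ (fun a b => tens a (tens b c))).
  by split=> [b|a] x u v /=; rewrite ?tensDl ?tensZl ?tensDr ?tensZr.
have [h hE] := choice ex.
have [|H HE] := @tens_lift (comp A B) C _ (fun w c => h c w).
  split=> [c|w] x u v /=; first by rewrite linearP.
  move: w; apply: tens_ind => [k w w'|k w w'|a b].
  - by rewrite linearP.
  - by rewrite !hom_linear !scalerDr !scalerA (mulrC x) addrACA.
  - by rewrite !hE ?tensDr ?tensZr.
by exists H => a b c; rewrite HE hE.
Qed.

Lemma tens_assoc_inv_exists A B C :
  exists H : 'Hom(V (comp A (comp B C)), V (comp (comp A B) C)),
    forall a b c, H (tens a (tens b c)) = tens (tens a b) c.
Proof.
have ex a : exists h : 'Hom(V (comp B C), V (comp (comp A B) C)),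
    forall b c, h (tens b c) = tens (tens a b) c.
  apply: (@tens_lift _ _ _ (fun b c => tens (tens a b) c)).
  by split=> [c|b] x u v /=; rewrite ?tensDl ?tensZl ?tensDr ?tensZr ?tensDl ?tensZl.
have [h hE] := choice ex.
have [|H HE] := @tens_lift A (comp B C) _ (fun a w => h a w).
  split=> [w|a] x u v /=; last by rewrite linearP.
  move: w; apply: tens_ind => [k w w'|k w w'|b c].
  - by rewrite linearP.
  - by rewrite !hom_linear !scalerDr !scalerA (mulrC x) addrACA.
  - by rewrite !hE ?tensDl ?tensZl ?tensDl ?tensZl.
by exists H => a b c; rewrite HE hE.
Qed.

Lemma scal_one : (scal (one : V (triv : S)) : R^o) = 1.
Proof.
have [k _ scalK] := @scal_bij R S.
apply: limg_lfunVK; apply/memv_imgP.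
by exists (k 1); rewrite ?memvf ?scalK.
Qed.

Lemma scal_inj : injective (@scal R S).
Proof. exact: bij_inj (@scal_bij R S). Qed.

Lemma scal_oneP (v : V (triv : S)) : v = (scal v : R) *: one.
Proof. by apply: scal_inj; rewrite linearZ /= scal_one /GRing.scale /= mulr1. Qed.

Lemma clsR_inj X : injective (@clsR R S X).
Proof. exact: bij_inj (@clsR_bij R S X). Qed.

Lemma clsR_pt (X : finType) (x : X) :
  clsR X (pt x : V (cls X : S)) = [ffun y => (y == x)%:R].
Proof.
have [k _ kK] := @clsR_bij R S X.
apply: limg_lfunVK; apply/memv_imgP.
by exists (k [ffun y => (y == x)%:R]); rewrite ?memvf ?kK.
Qed.

Lemma cls_decomp (X : finType) (v : V (cls X : S)) :
  v = \sum_(x : X) (clsR X v x : R) *: pt x.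
Proof.
apply: clsR_inj; rewrite linear_sum /=; apply/ffunP => y.
rewrite sum_ffunE (bigD1 y) //= big1 => [|x xy].
  by rewrite addr0 linearZ /= ffunE clsR_pt ffunE eqxx /GRing.scale /= mulr1.
rewrite linearZ /= ffunE clsR_pt ffunE eq_sym (negPf xy).
by rewrite /GRing.scale /= mulr0.
Qed.

End Tensor.

(** * Wires in a theory *)

Section Wiring.
Variables (R : realType) (T : gpt R).

Lemma trans_tens_exists (A A' B B' : T) (E : 'Hom(V A, V A')) (F : 'Hom(V B, V B')) :
  trans T E -> trans T F ->
  exists2 H : 'Hom(V (comp A B), V (comp A' B')), trans T H &
    forall a b, H (tens a b) = tens (E a) (F b).
Proof.
move=> tE tF; have [H HE] := tens_map_exists E F.
by exists H => //; apply: trans_tens tE tF HE.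
Qed.

(** The adjacent transposition in a right-nested composite, from which all reorderings of wires are
    generated. *)
Lemma trans_swap12 (A B C : T) :
  exists2 H : 'Hom(V (comp A (comp B C)), V (comp B (comp A C))), trans T H &
    forall a b c, H (tens a (tens b c)) = tens b (tens a c).
Proof.
have [H1 H1E] := tens_assoc_inv_exists A B C.
have [H2 H2E] := tens_swap_exists A B.
have [H3 tH3 H3E] := trans_tens_exists (trans_swap H2E) (trans_id C).
have [H4 H4E] := tens_assoc_exists B A C.
exists (H4 \o (H3 \o H1))%VF.
  apply: trans_comp (trans_assoc H4E); apply: trans_comp tH3.
  exact: trans_assoc_inv H1E.
by move=> a b c; rewrite !comp_lfunE H1E H3E id_lfunE H2E H4E.
Qed.

Lemma trans_unitl_exists (A : T) :
  exists2 H : 'Hom(V (comp triv A), V A), trans T H & forall a, H (tens one a) = a.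
Proof.
have [|H HE] := @tens_lift _ _ (triv : T) A _ (fun r a => (scal r : R) *: a).
  split=> [a|r] c u v /=; last by rewrite scalerDr !scalerA mulrC.
  by rewrite hom_linear scalerDl scalerA.
have HE1 a : H (tens one a) = a by rewrite HE scal_one scale1r.
by exists H => //; apply: trans_unitl HE1.
Qed.

Lemma trans_unitl_inv_exists (A : T) :
  exists2 H : 'Hom(V A, V (comp triv A)), trans T H & forall a, H a = tens one a.
Proof.
have [c u v|H HE] := @linear_hom _ _ _ (fun a : V A => tens (one : V (triv : T)) a).
  by rewrite tensPr.
by exists H => //; apply: trans_unitl_inv HE.
Qed.

Variables (W : eqType) (ws : W -> T).
Implicit Types (f : forall w, V (ws w)) (s t : seq W).

Lemma eq_tprod f f' s : {in s, forall w, f w = f' w} -> tprod f s = tprod f' s.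
Proof.
elim: s => //= w s IHs ff'; rewrite ff' ?mem_head // IHs // => w' ws'.
by apply: ff'; rewrite inE ws' orbT.
Qed.

Lemma eq_cotprod (f f' : forall w, 'Hom(V (ws w), R^o)) s :
  {in s, forall w, f w = f' w} -> cotprod f s = cotprod f' s.
Proof.
elim: s => //= w s IHs ff'; rewrite ff' ?mem_head // IHs // => w' ws'.
by apply: ff'; rewrite inE ws' orbT.
Qed.

(** Composites are indexed by ordered lists of wires, so gates can be composed only after a
    reordering. It is built recursively by moving the head wire to its place. *)
Lemma trans_perm s t : perm_eq s t ->
  exists2 H : 'Hom(V (comps ws s), V (comps ws t)), trans T H &
    forall f, H (tprod f s) = tprod f t.
Proof.
have move_head w t1 t2 :
    exists2 H : 'Hom(V (comps ws (w :: t1 ++ t2)), V (comps ws (t1 ++ w :: t2))),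
      trans T H & forall f, H (tprod f (w :: t1 ++ t2)) = tprod f (t1 ++ w :: t2).
  elim: t1 => [|a t1 [H tH HE]] /=.
    by exists \1%VF => [|f]; [exact: trans_id | rewrite id_lfunE].
  have [H1 tH1 H1E] := trans_swap12 (ws w) (ws a) (comps ws (t1 ++ t2)).
  have [H2 tH2 H2E] := trans_tens_exists (trans_id (ws a)) tH.
  exists (H2 \o H1)%VF => [|f]; first exact: trans_comp tH1 tH2.
  by rewrite comp_lfunE H1E H2E id_lfunE HE.
elim: s t => [|w s IHs] t st.
  have -> : t = [::] by apply/perm_nilP; rewrite perm_sym.
  by exists \1%VF => [|f]; [exact: trans_id | rewrite id_lfunE].
have wt : w \in t by rewrite -(perm_mem st) mem_head.
case/splitPr: wt st => t1 t2 st.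
have {}st : perm_eq s (t1 ++ t2).
  by rewrite -(perm_cons w) (perm_trans st) // (perm_catCA t1 [:: w] t2).
have [H1 tH1 H1E] := IHs _ st.
have [H2 tH2 H2E] := trans_tens_exists (trans_id (ws w)) tH1.
have [H3 tH3 H3E] := move_head w t1 t2.
exists (H3 \o H2)%VF => [|f]; first exact: trans_comp tH2 tH3.
by rewrite comp_lfunE /= H2E id_lfunE H1E -H3E.
Qed.

Lemma trans_cat s t :
  exists2 H : 'Hom(V (comp (comps ws s) (comps ws t)), V (comps ws (s ++ t))),
    trans T H & forall f, H (tens (tprod f s) (tprod f t)) = tprod f (s ++ t).
Proof.
elim: s => [|w s [H tH HE]] /=.
  by have [H tH HE] := trans_unitl_exists (comps ws t); exists H => // f; rewrite HE.
have [H1 H1E] := tens_assoc_exists (ws w) (comps ws s) (comps ws t).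
have [H2 tH2 H2E] := trans_tens_exists (trans_id (ws w)) tH.
exists (H2 \o H1)%VF => [|f]; first exact: trans_comp (trans_assoc H1E) tH2.
by rewrite comp_lfunE H1E H2E id_lfunE HE.
Qed.

Lemma trans_split s t :
  exists2 H : 'Hom(V (comps ws (s ++ t)), V (comp (comps ws s) (comps ws t))),
    trans T H & forall f, H (tprod f (s ++ t)) = tens (tprod f s) (tprod f t).
Proof.
elim: s => [|w s [H tH HE]] /=.
  by have [H tH HE] := trans_unitl_inv_exists (comps ws t); exists H => // f; rewrite HE.
have [H1 H1E] := tens_assoc_inv_exists (ws w) (comps ws s) (comps ws t).
have [H2 tH2 H2E] := trans_tens_exists (trans_id (ws w)) tH.
exists (H1 \o H2)%VF => [|f]; first exact: trans_comp tH2 (trans_assoc_inv H1E).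
by rewrite comp_lfunE H2E id_lfunE HE H1E.
Qed.

(** Feeds fixed states into the wires outside [m]. This sets the observed inputs of a gate to given
    values and, for empty [m], prepares a whole product state. *)
Lemma trans_insert (m : pred W) f s :
  (forall w, ~~ m w -> is_state (@trans R T) (f w)) ->
  exists2 M : 'Hom(V (comps ws (filter m s)), V (comps ws s)), trans T M &
    forall f', {in s, forall w, ~~ m w -> f' w = f w} ->
      M (tprod f' (filter m s)) = tprod f' s.
Proof.
move=> fst; elim: s => [|w s [M tM ME]] /=.
  by exists \1%VF => [|f' _]; [exact: trans_id | rewrite id_lfunE].
have sub f' : {in w :: s, forall w, ~~ m w -> f' w = f w} ->
    {in s, forall w, ~~ m w -> f' w = f w}.
  by move=> h w' ws'; apply: h; rewrite inE ws' orbT.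
case: ifPn => mw.
  have [H tH HE] := trans_tens_exists (trans_id (ws w)) tM.
  by exists H => // f' /sub h /=; rewrite HE id_lfunE ME.
have [E tE fE] := fst w mw.
have [H tH HE] := trans_tens_exists tE tM.
have [H1 tH1 H1E] := trans_unitl_inv_exists (comps ws (filter m s)).
exists (H \o H1)%VF => [|f' h]; first exact: trans_comp tH1 tH.
by rewrite comp_lfunE H1E HE -fE ME ?h ?mem_head //; apply: sub.
Qed.

Lemma unit_eff_tprod f s :
  (scal (unit_eff _ (tprod f s)) : R^o) =
  \prod_(w <- s) (scal (unit_eff (ws w) (f w)) : R).
Proof.
elim: s => [|w s IHs] /=; first by rewrite unit_eff_triv id_lfunE scal_one big_nil.
by rewrite big_cons unit_eff_comp IHs.
Qed.

End Wiring.

(** * Expansion of the outputs of a gate in bases *)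

Section Expansion.
Variables (R : realType) (T : gpt R) (W : finType) (ws : W -> T).
Variables (Iw : W -> finType).
Variables (vec : forall w, Iw w -> V (ws w)).
Variables (cov : forall w, Iw w -> 'Hom(V (ws w), R^o)).
Hypothesis vec_cov : forall w v, v = \sum_(t : Iw w) (cov t v : R) *: vec t.
Implicit Types (z : {dffun forall w, Iw w}).

Lemma sum_scale_linear (U Z : vectType R) (I : Type) (r : seq I) (P : pred I)
    (c : I -> 'Hom(U, R^o)) (u : I -> Z) :
  linear (fun v => \sum_(i <- r | P i) (c i v : R) *: u i).
Proof.
move=> k v v'; rewrite scaler_sumr -big_split; apply: eq_bigr => i _.
by rewrite hom_linear scalerDl scalerA.
Qed.

(** The counterpart of [trans_insert] on the output side: the wires outside [m] are tested by the
    effects belonging to [z0], and the remaining ones are resolved in their bases. *)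
Lemma trans_expand (m : pred W) z0 s : uniq s ->
  (forall w (t : Iw w), ~~ m w ->
     exists2 e, trans T e & forall v, scal (e v) = cov t v :> R) ->
  exists2 M : 'Hom(V (comps ws s), V (comps ws (filter m s))), trans T M &
    forall z, {in s, forall w, ~~ m w -> z w = z0 w} -> forall v,
      M v = \sum_(z' | agree [pred w | (w \in s) && m w] z z')
        (cotprod (fun w => cov (z' w)) s v : R) *:
        tprod (fun w => vec (z' w)) (filter m s).
Proof.
move=> us covT; elim: s us => [|w s IHs] /=.
  move=> _; exists \1%VF => [|z _ v]; first exact: trans_id.
  rewrite id_lfunE (big_pred1 z) => [|z']; first exact: scal_oneP.
  exact: agree0.
case/andP=> ws' /IHs[M tM ME].
have sub z : {in w :: s, forall w, ~~ m w -> z w = z0 w} ->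
    {in s, forall w, ~~ m w -> z w = z0 w}.
  by move=> h w' ws''; apply: h; rewrite inE ws'' orbT.
case: ifPn => mw.
  have [H tH HE] := trans_tens_exists (trans_id (ws w)) tM.
  exists H => // z h; apply: tens_ind => [||a b]; first exact: linearP.
    exact: sum_scale_linear.
  rewrite HE id_lfunE.
  rewrite (eq_bigl (agree (predU [pred w | (w \in s) && m w] (pred1 w)) z)); last first.
    apply: eq_agree => w'; rewrite /= inE andb_orl orbC; congr (_ || _).
    by case: eqP => // ->.
  rewrite agree_nested => [|i /andP[si _]]; last by apply: contraNneq ws' => <-.
  rewrite {1}(vec_cov a) (ME z (sub _ h) b) tens_sumr; apply: eq_bigr => z1 _.
  rewrite agree_pred1 tens_suml; apply: eq_bigr => t _.
  rewrite /= set1f_eq cotensE tensZl tensZr scalerA.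
  have zE : {in s, forall w', set1f z1 t w' = z1 w'}.
    by move=> w' sw'; rewrite set1f_neq //; apply: contraNneq ws' => ->.
  rewrite [in RHS](@eq_cotprod _ _ _ _ _ (fun w => cov (z1 w))) => [|w' sw']; last by rewrite zE.
  rewrite [in RHS](@eq_tprod _ _ _ _ _ (fun w => vec (z1 w))) // => w'.
  by rewrite mem_filter => /andP[_ sw']; rewrite zE.
have [e te eE] := covT w (z0 w) mw.
have [H tH HE] := trans_tens_exists te tM.
have [H1 tH1 H1E] := trans_unitl_exists (comps ws (filter m s)).
exists (H1 \o H)%VF => [|z h]; first exact: trans_comp tH tH1.
apply: tens_ind => [||a b]; first exact: linearP.
  exact: sum_scale_linear.
rewrite comp_lfunE HE (scal_oneP (e a)) tensZl linearZ /= H1E.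
rewrite (ME z (sub _ h) b) scaler_sumr; apply: eq_big => [z'|z' /agreeP h'].
  apply: eq_agree => w'; rewrite /= inE andb_orl.
  by case: eqP => //= ->; rewrite (negPf mw).
rewrite /= cotensE scalerA eE -h' ?h ?mem_head //.
by rewrite /= (negPf mw) andbF.
Qed.

Lemma tprod_expand z s v : uniq s ->
  v = \sum_(z' | agree (mem s) z z')
    (cotprod (fun w => cov (z' w)) s v : R) *: tprod (fun w => vec (z' w)) s.
Proof.
elim: s v => [|w s IHs] v /=.
  move=> _; rewrite (big_pred1 z) => [|z']; first exact: scal_oneP.
  exact: agree0.
case/andP=> ws' us; move: v; apply: tens_ind => [|| a b].
- by move=> k u v.
- exact: sum_scale_linear.
rewrite (eq_bigl (agree (predU (mem s) (pred1 w)) z)); last first.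
  by apply: eq_agree => w'; rewrite /= inE orbC.
rewrite agree_nested => [|i si]; last by apply: contraNneq ws' => <-.
rewrite {1}(vec_cov a) {1}(IHs b us) tens_sumr; apply: eq_bigr => z1 _.
rewrite agree_pred1 tens_suml; apply: eq_bigr => t _.
rewrite /= set1f_eq cotensE tensZl tensZr scalerA.
have zE : {in s, forall w', set1f z1 t w' = z1 w'}.
  by move=> w' sw'; rewrite set1f_neq //; apply: contraNneq ws' => ->.
rewrite [in RHS](@eq_cotprod _ _ _ _ _ (fun w => cov (z1 w))) => [|w' sw']; last by rewrite zE.
by rewrite [in RHS](@eq_tprod _ _ _ _ _ (fun w => vec (z1 w))) // => w' sw'; rewrite zE.
Qed.

End Expansion.

(** * Processing the gates of a circuit *)

Section Order.
Variable C : causal_structure.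
Implicit Types (g h : gate C) (U : {set gate C}).

(** All that is reachable from [h] is reachable from [g], while acyclicity excludes [g] itself. The
    cardinality thus serves as a rank of gates. *)
Lemma rank_edge g h : gate_edge g h ->
  (#|connect (@gate_edge C) h| < #|connect (@gate_edge C) g|)%N.
Proof.
move=> gh; apply: proper_card; apply/properP; split.
  by apply/subsetP => k hk; apply: connect_trans (connect1 gh) hk.
by exists g; [apply: connect0 | apply: shape_acyclic].
Qed.

Lemma gate_edge_irr g : ~~ gate_edge g g.
Proof. by apply/negP => /rank_edge; rewrite ltnn. Qed.

(* The gates are processed from the last one to the first one. *)
Lemma gate_ind (P : {set gate C} -> Prop) :
  P set0 ->
  (forall U g, g \notin U -> (forall h, gate_edge g h -> h \in U) ->
     (forall h, h \in U -> ~~ gate_edge h g) -> P U -> P (g |: U)) ->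
  P setT.
Proof.
(* The induction is on the number of gates outside [U], with [U] kept closed under successors. *)
move=> P0 PS; suff: forall n U, #|~: U| = n ->
    (forall g h, g \in U -> gate_edge g h -> h \in U) -> P U -> P setT.
  by move/(_ _ set0 erefl); apply=> // g h; rewrite inE.
elim=> [|n IHn] U cardU upU PU.
  by move/eqP: cardU; rewrite cards_eq0 => /eqP/(congr1 (@setC _));
     rewrite setCK setC0 => <-.
have [g0] : exists g, g \in ~: U by apply/card_gt0P; rewrite cardU.
rewrite inE => g0U.
pose rank g := #|connect (@gate_edge C) g|.
(* A gate of minimal rank outside [U] has all its successors in [U]. *)
case: (@arg_minnP _ g0 [pred g | g \notin U] rank g0U) => g gU ming.
have gout h : gate_edge g h -> h \in U.
  move=> gh; apply: contraT => hU; have := ming h hU.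
  by rewrite leqNgt rank_edge.
rewrite /= in gU; apply: (IHn (g |: U)).
- apply: succn_inj; rewrite -cardU (cardsD1 g (~: U)). rewrite in_setC gU add1n.
  by congr _.+1; apply: eq_card => h; rewrite !inE negb_or.
- move=> h k; rewrite !inE => /orP[/eqP ->|hU] hk; first by rewrite gout ?orbT.
  by rewrite (upU h) ?orbT.
by apply: PS => // h hU; apply: contra gU; apply: upU.
Qed.

End Order.

(** * Classical states and effects *)

Section Classical.
Variables (R : realType) (T : gpt R).

Lemma triv_hom (B : T) (v : V B) : exists H : 'Hom(V (triv : T), V B), H one = v.
Proof.
have [c u w|H HE] := @linear_hom _ _ _ (fun r : V (triv : T) => (scal r : R) *: v).
  by rewrite hom_linear scalerDl scalerA.
by exists H; rewrite HE scal_one scale1r.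
Qed.

Lemma cls_hom (X : finType) (B : T) (f : X -> V B) :
  exists H : 'Hom(V (cls X : T), V B), forall x, H (pt x) = f x.
Proof.
have [c u w|H HE] :=
    @linear_hom _ _ _ (fun v : V (cls X : T) => \sum_x (clsR X v x : R) *: f x).
  rewrite scaler_sumr -big_split; apply: eq_bigr => x _.
  by rewrite hom_linear !ffunE scalerDl scalerA.
exists H => x; rewrite HE (bigD1 x) //= big1 => [|y yx].
  by rewrite clsR_pt ffunE eqxx scale1r addr0.
by rewrite clsR_pt ffunE (negPf yx) scale0r.
Qed.

Lemma clsR_sum (X : finType) (p : X -> R) y :
  clsR X (\sum_x p x *: (pt x : V (cls X : T))) y = p y.
Proof.
rewrite linear_sum /= sum_ffunE (bigD1 y) //= big1 => [|x xy].
  by rewrite linearZ /= ffunE clsR_pt ffunE eqxx addr0 /GRing.scale /= mulr1.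
by rewrite linearZ /= ffunE clsR_pt ffunE eq_sym (negPf xy) /GRing.scale /= mulr0.
Qed.

(** A subnormalized distribution is a substochastic matrix out of the one-point system, which is
    identified with the trivial system by [trans_cls_triv_inv]. *)
Lemma cls_state (X : finType) (p : X -> R) :
  (forall x, 0 <= p x) -> \sum_x p x <= 1 ->
  is_state (@trans R T) (\sum_x p x *: (pt x : V (cls X : T))).
Proof.
move=> p0 p1; set v := \sum_x _.
have [H1 H1E] := triv_hom (pt tt : V (cls unit : T)).
have [H2 H2E] := @cls_hom unit (cls X) (fun=> v).
exists (H2 \o H1)%VF; last by rewrite comp_lfunE H1E H2E.
apply: trans_comp (trans_cls_triv_inv H1E) _.
apply/trans_cls; split=> x => [y|]; first by rewrite /cls_mx H2E clsR_sum.
by under eq_bigr do rewrite /cls_mx H2E clsR_sum.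
Qed.

Lemma pt_state (X : finType) (x : X) : is_state (@trans R T) (pt x : V (cls X : T)).
Proof.
have -> : pt x = \sum_y (y == x)%:R *: (pt y : V (cls X : T)).
  rewrite (bigD1 x) //= eqxx scale1r big1 ?addr0 // => y yx.
  by rewrite (negPf yx) scale0r.
apply: cls_state => [y|]; first exact: ler0n.
rewrite (bigD1 x) //= eqxx big1 ?addr0 // => y yx; by rewrite (negPf yx).
Qed.

Lemma cls_effect (X : finType) (x : X) :
  exists2 e : 'Hom(V (cls X : T), V triv), trans T e &
    forall v, scal (e v) = clsR X v x :> R.
Proof.
have [H1 H1E] := @cls_hom X (cls unit) (fun y => (y == x)%:R *: (pt tt : V (cls unit : T))).
have [H2 H2E] := @cls_hom unit (triv : T) (fun=> one).
have H2T : trans T H2 by apply: trans_cls_triv; rewrite H2E.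
exists (H2 \o H1)%VF.
  apply: trans_comp H2T; apply/trans_cls.
  have HE y t : cls_mx H1 t y = (y == x)%:R.
    rewrite /cls_mx H1E linearZ /= ffunE clsR_pt ffunE /GRing.scale /=.
    by case: t; rewrite mulr1.
  split=> [y t|y]; first by rewrite HE ler0n.
  under eq_bigr do rewrite HE.
  by rewrite big_const card_unit /= addr0 lern1 leq_b1.
move=> v; rewrite [in LHS](cls_decomp v) comp_lfunE !linear_sum /= (bigD1 x) //= big1.
  rewrite addr0 !linearZ /= H1E eqxx scale1r H2E scal_one.
  by rewrite /GRing.scale /= mulr1.
move=> y yx; rewrite !linearZ /= H1E (negPf yx) scale0r !linear0 ?scaler0 //.
Qed.

Lemma unit_eff_pt (X : finType) (x : X) :
  (scal (unit_eff (cls X) (pt x : V (cls X : T))) : R^o) = 1.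
Proof.
rewrite unit_eff_cls (bigD1 x) //= big1 => [|y yx]; rewrite clsR_pt ffunE.
  by rewrite eqxx addr0.
by rewrite (negPf yx).
Qed.

End Classical.

(** * Nonnegativity of circuit values *)

Section Contraction.
Variables (R : realType) (T : gpt R) (C : causal_structure).
Variables (al : obs C -> finType) (lsys : latent C -> T).
Local Notation ws := (wsys al lsys).
Variable E : forall g : gate C, 'Hom(V (comps ws (win g)), V (comps ws (wout g))).

(** Basis indices of latent wires and values of observed variables are put on the same footing, so
    that a single function [z] labels the whole circuit. *)
Definition widx (w : wire C) : finType :=
  match w with inl l => 'I_(\dim {: V (lsys l)}) | inr v => al v end.

Definition lvec (w : wire C) : widx w -> V (ws w) :=
  match w with
  | inl l => fun t => (vbasis {: V (lsys l)})`_t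
  | inr v => fun t => pt t
  end.

Definition lcov (w : wire C) : widx w -> 'Hom(V (ws w), R^o) :=
  match w with
  | inl l => fun t => linfun (coord (vbasis {: V (lsys l)}) t : _ -> R^o)
  | inr v => fun t => linfun (fun y => clsR (al v) y t : R^o)
  end.

Implicit Types (z : {dffun forall w, widx w}) (x : {dffun forall v : obs C, al v})
  (U : {set gate C}) (m : pred (wire C)).

(** The rule [lfunE] needs a bundled linear function, whereas [linfun] in [lcov] is applied to a
    bare one; bundling it afterwards suffices. *)
Lemma lcov_obs v (t : al v) (y : V (cls (al v))) :
  lcov (w := inr v) t y = clsR (al v) y t.
Proof.
pose f : V (cls (al v) : T) -> R^o := fun y => clsR (al v) y t.
have lin : linear f by move=> c u w; rewrite /f hom_linear !ffunE.
pose linM := GRing.isLinear.Build _ _ _ _ f lin.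
pose F : {linear V (cls (al v) : T) -> R^o} := HB.pack f linM.
exact: (lfunE F).
Qed.

Lemma lvec_lcov w (v : V (ws w)) : v = \sum_(t : widx w) (lcov t v : R) *: lvec t.
Proof.
case: w v => [l|o] v /=; last first.
  by rewrite [LHS]cls_decomp; apply: eq_bigr => t _; rewrite lcov_obs.
rewrite [LHS](coord_vbasis (memvf v)); apply: eq_bigr => t _.
by rewrite lfunE.
Qed.

Definition term z (g : gate C) : R :=
  cotprod (fun w => lcov (z w)) (wout g) (E g (tprod (fun w => lvec (z w)) (win g))).

Lemma mem_win (g : gate C) (w : wire C) : (w \in win g) = wfed w g.
Proof. by rewrite mem_filter mem_enum andbT. Qed.

Lemma mem_wout (g : gate C) (w : wire C) : (w \in wout g) = (wsrc w == Some g).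
Proof. by rewrite mem_filter mem_enum andbT. Qed.

Lemma wire_edge g h (w : wire C) : wsrc w = Some g -> wfed w h -> gate_edge g h.
Proof. by move=> wg wh; apply/existsP; exists w; rewrite wg eqxx. Qed.

Lemma eq_term z z' g :
  (forall w : wire C, wfed w g || (wsrc w == Some g) -> z w = z' w) -> term z g = term z' g.
Proof.
move=> zz'; rewrite /term (@eq_tprod _ _ _ _ _ (fun w => lvec (z' w))).
  rewrite [in LHS](@eq_cotprod _ _ _ _ _ (fun w => lcov (z' w))) // => w.
  by rewrite mem_wout => wg; rewrite zz' // wg orbT.
by move=> w; rewrite mem_win => wg; rewrite zz' // wg.
Qed.

Definition srcs m U : pred (wire C) :=
  fun w => m w && (if wsrc w is Some g then g \in U else false).

(** The tensor network of the gates in [U] alone, with the wires entering from outside fixed by [z].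
    For [m = is_latent] it extends the circuit value to parts of the circuit; for [m = predT] the
    observed outputs are summed over too, giving the total mass. *)
Definition contraction m U z : R :=
  \sum_(z' | agree (srcs m U) z z') \prod_(g in U) term z' g.

Lemma contraction0 m z : contraction m set0 z = 1.
Proof.
rewrite /contraction (big_pred1 z) => [|z']; first by rewrite big_set0.
by apply: agree0 => w; rewrite /srcs; case: (wsrc w) => [g|]; rewrite ?inE andbF.
Qed.

(** No gate of [U] feeds [g], so no wire at [g] is summed over inside [U] and the term of [g]
    factors out of the inner sum. *)
Lemma contractionS m U g z : g \notin U -> (forall h, h \in U -> ~~ gate_edge h g) ->
  contraction m (g |: U) z =
  \sum_(z1 | agree [pred w | (w \in wout g) && m w] z z1) term z1 g * contraction m U z1.
Proof.
move=> gU Ug; rewrite /contraction.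
rewrite (eq_bigl (agree (predU [pred w | (w \in wout g) && m w] (srcs m U)) z)); last first.
  apply: eq_agree => w; rewrite /= /srcs mem_wout.
  case: (m w); rewrite /= ?andbT ?andbF //.
  by case: (wsrc w) => //= h; rewrite !inE.
rewrite agree_nested => [|w /andP[]]; last first.
  by rewrite mem_wout /srcs => /eqP -> _; rewrite (negPf gU) andbF.
apply: eq_bigr => z1 _; rewrite mulr_sumr; apply: eq_bigr => z' /agreeP h.
rewrite big_setU1 //=; congr (_ * _); apply: eq_term => w gw; rewrite h //.
apply/negP => /andP[_]; case wsrcw: (wsrc w) gw => [k|] //= gw kU.
case/orP: gw => [wg|/eqP[kg]]; last by rewrite -kg kU in gU.
by have := Ug k kU; rewrite (wire_edge wsrcw wg).
Qed.

Definition frontier U (w : wire C) : bool :=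
  if w is inl l then (ltgt l \in U) && (lsrc l \notin U) else false.

Definition is_latent (w : wire C) : bool := if w is inl _ then true else false.


Definition frontier_seq U : seq (wire C) := [seq w <- enum (wire C) | frontier U w].

(* Why circuit values are nonnegative: the gates of a final segment [U] of the
   circuit, with all observed variables fixed, form an effect on the latent wires
   entering [U]. *)
Definition contraction_is_effect U : Prop :=
  forall z0, exists2 e : 'Hom(V (comps ws (frontier_seq U)), V triv), trans T e &
    forall z, (forall v, z (inr v) = z0 (inr v)) ->
      scal (e (tprod (fun w => lvec (z w)) (frontier_seq U))) =
      contraction is_latent U z :> R.

Lemma contraction_is_effect0 : contraction_is_effect set0.
Proof.
move=> z0; rewrite /frontier_seq.
have -> : [seq w <- enum (wire C) | frontier set0 w] = [::].
  by rewrite -(filter_pred0 (enum (wire C))); apply: eq_filter => -[l|v] //=; rewrite inE.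
exists \1%VF => [|z _]; first exact: trans_id.
by rewrite contraction0 /= id_lfunE scal_one.
Qed.

(** The new effect lets [rest], the frontier wires not produced by [g], pass by. It inserts the
    fixed values of the observed inputs of [g], applies [g], tests its observed outputs, and applies
    the effect of [U]. All latent outputs of [g] enter [U], so they and [rest] make up the frontier
    of [U]. *)
Lemma contraction_is_effectS U g : (forall g, trans T (E g)) ->
  g \notin U -> (forall h, gate_edge g h -> h \in U) ->
  (forall h, h \in U -> ~~ gate_edge h g) ->
  contraction_is_effect U -> contraction_is_effect (g |: U).
Proof.
move=> tE gU gout Ug IH z0; have [e te eE] := IH z0.
pose lin := filter is_latent (win g); pose lout := filter is_latent (wout g).
pose rest := [seq w <- frontier_seq U | wsrc w != Some g].
have uF U' : uniq (frontier_seq U') by apply: filter_uniq; apply: enum_uniq.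
have uin : uniq lin by do 2!apply: filter_uniq; apply: enum_uniq.
have uout : uniq lout by do 2!apply: filter_uniq; apply: enum_uniq.
have memF U' w : (w \in frontier_seq U') = frontier U' w.
  by rewrite mem_filter mem_enum andbT.
have memlin w : (w \in lin) = is_latent w && wfed w g.
  by rewrite mem_filter mem_win.
have memlout w : (w \in lout) = is_latent w && (wsrc w == Some g).
  by rewrite mem_filter mem_wout.
have memrest w : (w \in rest) = (wsrc w != Some g) && frontier U w.
  by rewrite mem_filter memF.
have srcU (l : latent C) : ltgt l = g -> lsrc l \notin U /\ lsrc l != g.
  move=> lg; have lE : gate_edge (lsrc l) g.
    by apply: (@wire_edge _ _ (inl l)) => //=; rewrite lg.
  split; first by apply/negP => /Ug; rewrite lE.
  by apply: contraTneq lE => ->; exact: gate_edge_irr.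
have p1 : perm_eq (lout ++ rest) (frontier_seq U).
  apply: uniq_perm => //.
    rewrite cat_uniq uout filter_uniq ?uF // andbT; apply/hasPn => w.
    by rewrite memrest memlout => /andP[/negPf->]; rewrite andbF.
  move=> w; rewrite mem_cat memlout memrest memF.
  case: w => [l|v] //=; last by rewrite andbF.
  case: (eqVneq (Some (lsrc l)) (Some g)) => //= -[lg].
  rewrite lg gU andbT; apply/esym/gout.
  by apply: (@wire_edge _ _ (inl l)) => //=; rewrite lg.
have p2 : perm_eq (frontier_seq (g |: U)) (lin ++ rest).
  apply: uniq_perm => //.
    rewrite cat_uniq uin filter_uniq ?uF // andbT; apply/hasPn => w.
    rewrite memrest memlin; case: w => [l|v]; last by rewrite andbF.
    by move=> /andP[_ /= /andP[lU _]]; apply: contraNneq gU => <-.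
  move=> w; rewrite mem_cat memlin memrest memF.
  case: w => [l|v] //=; last by rewrite andbF.
  rewrite !inE negb_or; case: (eqVneq (ltgt l) g) => [/srcU[-> ->]//|_] /=.
  by rewrite andbCA.
have [Mout tMout MoutE] : exists2 M : 'Hom(V (comps ws (wout g)), V (comps ws lout)),
    trans T M & forall z, {in wout g, forall w, ~~ is_latent w -> z w = z0 w} -> forall v,
      M v = \sum_(z' | agree [pred w | (w \in wout g) && is_latent w] z z')
        (cotprod (fun w => lcov (z' w)) (wout g) v : R) *:
        tprod (fun w => lvec (z' w)) lout.
  apply: trans_expand; first exact: lvec_lcov.
    by rewrite filter_uniq ?enum_uniq.
  case=> [//|v] t _; have [e' te' e'E] := cls_effect T t.
  by exists e' => // y; rewrite e'E lcov_obs.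
pose f0 w := lvec (z0 w).
have [|Min tMin MinE] := @trans_insert _ _ _ _ is_latent f0 (win g).
  by case=> [//|v] _; apply: pt_state.
have [H1 tH1 H1E] := @trans_perm _ T _ ws _ _ p1.
have [H2 tH2 H2E] := @trans_perm _ T _ ws _ _ p2.
have [J tJ JE] := @trans_cat _ T _ ws lout rest.
have [S tS SE] := @trans_split _ T _ ws lin rest.
have tM : trans T (Mout \o (E g \o Min))%VF.
  by apply: trans_comp tMout; apply: trans_comp (tE g).
have [K tK KE] := trans_tens_exists tM (trans_id (comps ws rest)).
exists (e \o (H1 \o (J \o (K \o (S \o H2)))))%VF.
  by do !apply: trans_comp => //.
move=> z zz0; rewrite !comp_lfunE H2E SE KE id_lfunE !comp_lfunE.
rewrite MinE => [|[l|v] _ //= _]; last by rewrite /f0 zz0.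
rewrite (MoutE z) => [|[l|v] _ //= _].
rewrite tens_suml !linear_sum /= contractionS //; apply: eq_bigr => z1 /agreeP h.
rewrite tensZl !linearZ /=.
have -> : tprod (fun w => lvec (z w)) rest = tprod (fun w => lvec (z1 w)) rest.
  apply: eq_tprod => w; rewrite memrest => /andP[wg _]; rewrite h //=.
  by rewrite mem_wout (negPf wg).
rewrite JE H1E eE => [|v]; last by rewrite -h ?zz0 //= andbF.
congr (_ * _); rewrite /term; congr (cotprod _ _ (E g _)).
apply: eq_tprod => w; rewrite mem_win => wg; rewrite h //=.
rewrite mem_wout; apply/negP => /andP[/eqP sw _].
  by have := gate_edge_irr g; rewrite (wire_edge sw wg).
exact: zz0.
Qed.

Definition join (k : {dffun forall l : latent C, 'I_(\dim {: V (lsys l)})}) x :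
    {dffun forall w, widx w} :=
  [ffun w => match w return widx w with inl l => k l | inr v => x v end].

Lemma term_join k x g : term (join k x) g =
  cotprod (wcovec k x) (wout g) (E g (tprod (wvec k x) (win g))).
Proof.
rewrite /term (@eq_tprod _ _ _ _ _ (wvec k x)) => [|[l|v] _]; rewrite ?ffunE //.
by rewrite (@eq_cotprod _ _ _ _ _ (wcovec k x)) => [//|[l|v] _]; rewrite ffunE.
Qed.

Lemma circuit_value_contraction k x :
  circuit_value E x = contraction is_latent setT (join k x).
Proof.
rewrite /contraction /circuit_value (reindex_onto (fun k' => join k' x)
  (fun z => [ffun l => z (inl l)])) /=.
  apply: eq_big => [k'|k' _].
    apply/esym/andP; split.
      by apply/agreeP => -[l|v]; rewrite /srcs /= ?inE // !ffunE.
    by apply/eqP/ffunP => l; rewrite !ffunE.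
  by apply: eq_big => [g|g _]; rewrite ?inE // term_join.
move=> z /agreeP h; apply/ffunP => -[l|v]; rewrite !ffunE //.
by rewrite -h // ffunE.
Qed.

Lemma circuit_value_ge0 x : (forall g, trans T (E g)) -> 0 <= circuit_value E x.
Proof.
(* If some latent system has dimension 0, there is no index [k] and the circuit value is an empty
   sum. *)
move=> tE; case: (pickP {: {dffun forall l : latent C, 'I_(\dim {: V (lsys l)})}})
    => [k _|no_k]; last by rewrite /circuit_value big_pred0.
have [|U g gU gout Ug IH|e te eE] := @gate_ind C contraction_is_effect _ _ (join k x).
- exact: contraction_is_effect0.
- exact: contraction_is_effectS.
rewrite (circuit_value_contraction k) -eE //.
(* No wire enters the set of all gates from outside, so [e] is a closed circuit and its value is a
   probability. *)
move: e te {eE}; have -> : frontier_seq setT = [::].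
  by rewrite /frontier_seq -(filter_pred0 (enum (wire C))); apply: eq_filter => -[l|v] //=;
     rewrite !inE.
by move=> e /trans_closed/andP[].
Qed.

End Contraction.

(** * Normalization of circuit values *)

Section Normalization.
Variables (R : realType) (T : gpt R).

Lemma unit_eff_comp_eq0 (A B : T) :
  (unit_eff (comp A B) == 0) = (unit_eff A == 0) || (unit_eff B == 0).
Proof.
apply/eqP/orP => [uAB|[]/eqP u0]; last 2 first.
- apply: tens_ext => a b; apply: scal_inj; rewrite unit_eff_comp u0 !zero_lfunE.
  by rewrite !linear0 mul0r.
- apply: tens_ext => a b; apply: scal_inj; rewrite unit_eff_comp u0 !zero_lfunE.
  by rewrite !linear0 mulr0.
case: (eqVneq (unit_eff A) 0) => [|/lfunPn[a]]; first by left.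
rewrite zero_lfunE => ua; right; apply/eqP/lfunP => b; rewrite zero_lfunE.
have := unit_eff_comp a b; rewrite uAB zero_lfunE linear0 => /esym/eqP.
rewrite mulf_eq0 => /orP[]/eqP h; last by apply: scal_inj; rewrite linear0.
by case/eqP: ua; apply: scal_inj; rewrite linear0.
Qed.

Lemma unit_eff_comps_eq0 (W : Type) (ws : W -> T) (s : seq W) :
  (unit_eff (comps ws s) == 0) = has (fun w => unit_eff (ws w) == 0) s.
Proof.
elim: s => [|w s IHs] /=; last by rewrite unit_eff_comp_eq0 IHs.
rewrite unit_eff_triv; apply/eqP => /lfunP/(_ one).
rewrite id_lfunE zero_lfunE => /(congr1 scal)/eqP.
by rewrite scal_one linear0 oner_eq0.
Qed.

Variables (C : causal_structure) (al : obs C -> finType) (lsys : latent C -> T).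
Local Notation ws := (wsys al lsys).
Variable E : forall g : gate C, 'Hom(V (comps ws (win g)), V (comps ws (wout g))).
Hypothesis detE : forall g, deterministic (E g).

(** A vanishing unit effect propagates backwards: if it vanishes on an output of a deterministic
    gate, it vanishes on some input. That input is latent, since [x] shows the alphabets to be
    nonempty and classical unit effects are 1 on points. So its source is a bad gate of larger rank,
    and a bad gate of maximal rank is absurd. *)
Lemma latent_unit_neq0 (x : {dffun forall v, al v}) l : unit_eff (lsys l) != 0.
Proof.
pose bad g := has (fun w => unit_eff (ws w) == 0) (wout g).
suff nobad g : ~~ bad g.
  apply: contra (nobad (lsrc l)) => u0; apply/hasP; exists (inl l) => //.
  by rewrite mem_wout.
apply/negP => badg.
pose rank g := #|connect (@gate_edge C) g|.
case: (@arg_maxnP _ g bad rank badg) => h badh maxh.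
have : unit_eff (comps ws (win h)) == 0.
  rewrite -(detE h) (eqP (_ : unit_eff _ == 0)) ?unit_eff_comps_eq0 //.
  by rewrite comp_lfun0l.
rewrite unit_eff_comps_eq0 => /hasP[[l'|v]]; rewrite mem_win /= => hw u0.
  have badl : bad (lsrc l').
    by apply/hasP; exists (inl l'); rewrite ?mem_wout /=.
  have := maxh _ badl; rewrite /rank /= leqNgt rank_edge //.
  exact: (@wire_edge _ _ _ (inl l')).
have /eqP := unit_eff_pt T (x v).
by rewrite (eqP u0) zero_lfunE linear0 eq_sym oner_eq0.
Qed.

(** A system with nonzero unit effect has positive dimension. This excludes circuit values that are
    empty sums, which could not be normalized. *)
Lemma latent_index (x : {dffun forall v, al v}) :
  inhabited {dffun forall l : latent C, 'I_(\dim {: V (lsys l)})}.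
Proof.
have dim_gt0 l : (0 < \dim {: V (lsys l)})%N.
  rewrite lt0n dimv_eq0; apply: contraNneq (latent_unit_neq0 x l) => V0.
  apply/eqP/lfunP => v; have := memvf v; rewrite V0 memv0 => /eqP ->.
  by rewrite !linear0.
exact: (inhabits [ffun l => Ordinal (dim_gt0 l)]).
Qed.

Local Notation widx := (widx al lsys).
Implicit Types (z : {dffun forall w, widx w}).

Definition wunit z (w : wire C) : R := scal (unit_eff (ws w) (lvec (z w))).

Lemma unit_eff_lvec z s :
  (scal (unit_eff _ (tprod (fun w => lvec (z w)) s)) : R^o) = \prod_(w <- s) wunit z w.
Proof. exact: unit_eff_tprod. Qed.

(** Induction over final segments [U], whose total contraction is the product of the unit effects on
    the latent wires entering [U]. When [g] is added, the sum over its outputs is the unit effect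
    after [g], and by determinism this is the unit effect on the inputs of [g]. *)
Lemma contraction_total z : contraction E predT setT z = 1.
Proof.
suff: forall z, contraction E predT setT z = \prod_(w | frontier setT w) wunit z w.
  move=> ->; rewrite big_pred0 // => -[l|v] //=; by rewrite !inE.
apply: (@gate_ind C (fun U => forall z,
  contraction E predT U z = \prod_(w | frontier U w) wunit z w)) => [{}z|U g gU gout Ug IH {}z].
  by rewrite contraction0 big_pred0 // => -[l|v] //=; rewrite !inE.
rewrite contractionS //.
pose rest := [pred w : wire C | frontier U w && (wsrc w != Some g)].
have wunit_obs z1 v : wunit z1 (inr v) = 1 by rewrite /wunit /= unit_eff_pt.
(* The outputs of [g] on the frontier of [U] are split off and completed by its observed outputs,
   whose unit factors are 1. *)
transitivity (\sum_(z1 | agree (mem (wout g)) z z1) (\prod_(w | rest w) wunit z w) *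
    (term E z1 g * scal (unit_eff _ (tprod (fun w => lvec (z1 w)) (wout g))))).
  apply: eq_big => [z1|z1 /agreeP h]; first by apply: eq_agree => w; rewrite /= andbT.
  rewrite mulrCA; congr (_ * _); rewrite IH (bigID (fun w => wsrc w == Some g)) /= mulrC.
  congr (_ * _).
    apply: eq_bigr => w /andP[_ wg]; rewrite /wunit h //= mem_wout.
    by rewrite (negPf wg).
  rewrite unit_eff_lvec /wout big_filter big_enum_cond /=.
  rewrite [RHS](bigID (@is_latent C)) /= [X in _ * X]big1 ?mulr1; last first.
    by case=> [l|v] /andP[_ //] _; rewrite wunit_obs.
  apply: eq_bigl => -[l|v] //=; last by rewrite andbF.
  rewrite andbT; case: (eqVneq (Some (lsrc l)) (Some g)) => [[lg]|]; last by rewrite andbF.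
  rewrite lg gU !andbT; apply: gout.
  by apply: (@wire_edge _ _ _ (inl l)) => //=; rewrite lg.
rewrite -mulr_sumr.
have -> : \sum_(z1 | agree (mem (wout g)) z z1)
    (term E z1 g * scal (unit_eff _ (tprod (fun w => lvec (z1 w)) (wout g)))) =
    scal (unit_eff _ (E g (tprod (fun w => lvec (z w)) (win g)))).
  have uout : uniq (wout g) by apply: filter_uniq; apply: enum_uniq.
  set y := E g (tprod _ (win g)).
  rewrite [in RHS](tprod_expand (@lvec_lcov _ _ _ al lsys) z y uout).
  rewrite !linear_sum; apply: eq_bigr => z1 /agreeP h; rewrite !linearZ /=.
  congr (_ * _); rewrite /term /y; congr (cotprod _ _ (E g _)).
  apply: eq_tprod => w; rewrite mem_win => wg; rewrite h //= mem_wout.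
  apply/negP => /eqP sw.
  by have := gate_edge_irr g; rewrite (wire_edge sw wg).
rewrite -(comp_lfunE (unit_eff _) (E g)) detE unit_eff_lvec.
rewrite /win big_filter big_enum_cond /= [X in _ * X](bigID (@is_latent C)) /=.
rewrite [X in _ * (_ * X)]big1 ?mulr1; last first.
  by case=> [l|v] /andP[_ //] _; rewrite wunit_obs.
rewrite [RHS](bigID (fun w => wfed w g)) /= mulrC; congr (_ * _).
  apply: eq_bigl => -[l|v] //=; last by rewrite andbF.
  rewrite andbT !inE; case: (eqVneq (ltgt l) g) => [lg|_]; last by rewrite andbF.
  have lE : gate_edge (lsrc l) g by apply: (@wire_edge _ _ _ (inl l)) => //=; rewrite lg.
  rewrite /= andbT; apply/esym/norP; split.
    by apply: contraTneq lE => ->; exact: gate_edge_irr.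
  by apply: contraTN lE => /Ug.
apply: eq_bigl => -[l|v] //=; rewrite !inE negb_or.
rewrite (inj_eq (@Some_inj _)).
case: (eqVneq (ltgt l) g) => [lg|_] /=; last by rewrite andbT -andbA (andbC (_ \notin _)).
by rewrite lg (negPf gU) andbF.
Qed.

(** Grouping the total contraction by the values of the observed variables gives the circuit values;
    the open inputs have no source and stay at [x]. *)
Lemma circuit_value_sum x :
  \sum_(x' | agree (fun v => osrc v != None) x x') circuit_value E x' = 1.
Proof.
have [k] := latent_index x.
rewrite -(contraction_total (join k x)) /contraction.
pose obs_of (z : {dffun forall w, widx w}) : {dffun forall v, al v} := [ffun v => z (inr v)].
rewrite [RHS](partition_big obs_of (agree (fun v => osrc v != None) x)) /=; last first.
  move=> z /agreeP h; apply/agreeP => v vo; rewrite ffunE -h ?ffunE //.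
  by rewrite /srcs /=; move: vo; rewrite negbK => /eqP ->.
apply: eq_bigr => x' /agreeP h; rewrite (circuit_value_contraction E k) /contraction.
apply: eq_bigl => z; apply/agreeP/andP => [h'|[/agreeP h' /eqP <-]].
  split; last by apply/eqP/ffunP => v; rewrite ffunE -h' ?ffunE.
  apply/agreeP => -[l|v] sw; first by move: sw; rewrite /srcs /= inE.
  rewrite -h' // !ffunE h //; apply: contra sw.
  by rewrite /srcs /=; case: osrc => // g; rewrite inE.
case=> [l|v]; first by rewrite /srcs /= inE.
by rewrite !ffunE.
Qed.

End Normalization.

(** * Cutting a circuit into its districts *)

Section Boxes.
Variables (R : realType) (S : systems R).

Lemma existT_inj (I : Type) (P : I -> Type) i (a b : P i) :
  existT P i a = existT P i b -> a = b.
Proof.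
move=> e; have := projT2_eq e; rewrite (Prop_irrelevance (projT1_eq e) erefl).
by [].
Qed.

(* Linear maps (resp. vectors, forms) between (resp. in, on) systems that are
   only propositionally equal are compared as dependent pairs. *)
Definition box (A B : S) (E : 'Hom(V A, V B)) : {A : S & {B : S & 'Hom(V A, V B)}} :=
  existT _ A (existT _ B E).
Definition boxv (A : S) (v : V A) : {A : S & V A} := existT _ A v.
Definition boxf (A : S) (f : 'Hom(V A, R^o)) : {A : S & 'Hom(V A, R^o)} := existT _ A f.

Definition cast_hom (A A' B B' : S) (eA : A = A') (eB : B = B')
    (E : 'Hom(V A, V B)) : 'Hom(V A', V B') :=
  ecast B' 'Hom(V A', V B') eB (ecast A' 'Hom(V A', V B) eA E).

Lemma box_cast (A A' B B' : S) (eA : A = A') (eB : B = B') (E : 'Hom(V A, V B)) :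
  box (cast_hom eA eB E) = box E.
Proof. by case: A' / eA; case: B' / eB. Qed.

Lemma box_prop (K : forall A B : S, 'Hom(V A, V B) -> Prop) (A A' B B' : S)
    (E : 'Hom(V A, V B)) (E' : 'Hom(V A', V B')) : box E = box E' -> K _ _ E -> K _ _ E'.
Proof.
pose Kb (b : {A : S & {B : S & 'Hom(V A, V B)}}) := K _ _ (projT2 (projT2 b)).
by move=> e KE; rewrite -/(Kb (box E')) -e.
Qed.

(** Here boxed equalities turn into an equality of real numbers, whose type no longer mentions the
    systems. *)
Lemma box_value (A A' B B' : S) (E : 'Hom(V A, V B)) (E' : 'Hom(V A', V B'))
    a a' (c : 'Hom(V B, R^o)) (c' : 'Hom(V B', R^o)) :
  box E = box E' -> boxv a = boxv a' -> boxf c = boxf c' -> c (E a) = c' (E' a').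
Proof.
move=> eE ea ec; have eA : A = A' := congr1 (@projT1 _ _) ea.
have eB : B = B' := congr1 (@projT1 _ _) ec.
case: A' / eA E' a' eE ea => E' a' eE ea; case: B' / eB c' E' eE ec => c' E' eE ec.
by rewrite (existT_inj (existT_inj eE)) (existT_inj ea) (existT_inj ec).
Qed.

Variables (W W' : eqType) (ws : W -> S) (ws' : W' -> S) (emb : W' -> W).

Lemma comps_map s : {in s, forall w, ws (emb w) = ws' w} ->
  comps ws (map emb s) = comps ws' s.
Proof.
elim: s => //= w s IHs h; rewrite h ?mem_head // IHs // => w' ws''.
by apply: h; rewrite inE ws'' orbT.
Qed.

Lemma boxv_tprod f f' s : {in s, forall w, boxv (f (emb w)) = boxv (f' w)} ->
  boxv (tprod (ws := ws) f (map emb s)) = boxv (tprod (ws := ws') f' s).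
Proof.
pose F (p q : {A : S & V A}) : {A : S & V A} := boxv (tens (projT2 p) (projT2 q)).
elim: s => //= w s IHs h.
rewrite -/(F (boxv (f (emb w))) (boxv (tprod f (map emb s)))) h ?mem_head // IHs // => w' ws''.
by apply: h; rewrite inE ws'' orbT.
Qed.

Lemma boxf_cotprod f f' s : {in s, forall w, boxf (f (emb w)) = boxf (f' w)} ->
  boxf (cotprod (ws := ws) f (map emb s)) = boxf (cotprod (ws := ws') f' s).
Proof.
pose F (p q : {A : S & 'Hom(V A, R^o)}) := boxf (cotens (projT2 p) (projT2 q)).
elim: s => //= w s IHs h.
rewrite -/(F (boxf (f (emb w))) (boxf (cotprod f (map emb s)))) h ?mem_head // IHs // => w' ws''.
by apply: h; rewrite inE ws'' orbT.
Qed.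

End Boxes.

(** * The wires of a district inside the circuit *)

Section DistrictWires.
Variables (C : causal_structure) (r : gate C).
Local Notation D := (district r).

Definition emb (w : wire D) : wire C :=
  match w with inl l => inl (val l) | inr v => inr (val v) end.

Definition in_emb (w : wire C) : bool :=
  match w with
  | inl l => in_district r (lsrc l)
  | inr v => (if osrc v is Some g then in_district r g else false)
               || [exists g, in_district r g && (g \in ofed v)]
  end.

Lemma enum_sub (T : finType) (P : pred T) :
  map val (enum {: {x : T | P x}}) = [seq x <- enum T | P x].
Proof.
rewrite !enumT [in LHS]unlock /= pmap_filter; last exact: insubK.
by apply: eq_filter => x; apply: isSome_insub.
Qed.

Lemma enum_wire (A : circuit_shape) :
  enum (wire A) = map inl (enum (latent A)) ++ map inr (enum (obs A)).
Proof. by rewrite !enumT [in LHS]unlock /= /sum_enum -!enumT. Qed.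

(** A subtype is enumerated in the order of the ambient type. Hence the wire lists of a gate in its
    district and in the circuit match exactly, and a cast replaces a reordering transformation. *)
Lemma enum_emb : map emb (enum (wire D)) = [seq w <- enum (wire C) | in_emb w].
Proof.
rewrite !enum_wire map_cat filter_cat (filter_map inl) (filter_map inr); congr (_ ++ _).
  transitivity (map inl (map val (enum (latent D))) : seq (wire C)).
    by rewrite -[LHS]map_comp -[RHS]map_comp; apply: eq_map.
  by congr map; apply: enum_sub.
transitivity (map inr (map val (enum (obs D))) : seq (wire C)).
  by rewrite -[LHS]map_comp -[RHS]map_comp; apply: eq_map.
by congr map; apply: enum_sub.
Qed.

Lemma wfed_emb (w : wire D) (g : gate D) : wfed (emb w) (val g) = wfed w g.
Proof. by case: w => [l|v] //=; rewrite inE. Qed.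

Lemma wsrc_emb (w : wire D) (g : gate D) :
  (wsrc (emb w) == Some (val g)) = (wsrc w == Some g).
Proof.
case: w => [l|v] //=; case: (osrc (val v)) => //= h.
case: insubP => [u _ <- //|hD]; apply: contraNF hD => /eqP[->].
exact: valP.
Qed.

Lemma emb_win (g : gate D) : map emb (win g) = win (val g).
Proof.
rewrite /win (eq_filter (a2 := preim emb (fun w => wfed w (val g)))); last first.
  by move=> w; rewrite /= wfed_emb.
rewrite -filter_map enum_emb -filter_predI; apply: eq_filter => -[l|v] /=.
  case: eqP => //= lg; have : in_district r (ltgt l) by rewrite lg; apply: valP.
  move=> lD; apply: connect_trans lD (connect1 _).
  by apply/existsP; exists l; rewrite !eqxx orbT.
case: (boolP (val g \in ofed v)) => //= gv; apply/orP; right; apply/existsP.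
by exists (val g); rewrite gv andbT; apply: valP.
Qed.

Lemma emb_wout (g : gate D) : map emb (wout g) = wout (val g).
Proof.
rewrite /wout (eq_filter (a2 := preim emb (fun w => wsrc w == Some (val g)))); last first.
  by move=> w; rewrite /= wsrc_emb.
rewrite -filter_map enum_emb -filter_predI; apply: eq_filter => -[l|v] /=.
  by case: eqP => //= -[->]; apply: valP.
by case: eqP => //= ->; rewrite (valP g).
Qed.

End DistrictWires.

(** * Restricting models to districts and gluing them *)

Section Models.
Variables (R : realType) (T : gpt R).

Definition model (C : causal_structure) (al : obs C -> finType) : Type :=
  {ls : latent C -> T & forall g : gate C,
     'Hom(V (comps (wsys al ls) (win g)), V (comps (wsys al ls) (wout g)))}.

Definition model_value (C : causal_structure) (al : obs C -> finType) (m : model al) :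
  {dffun forall v, al v} -> R := circuit_value (projT2 m).

Definition valid (K : forall A B : T, 'Hom(V A, V B) -> Prop)
    (C : causal_structure) (al : obs C -> finType) (m : model al) : Prop :=
  (forall l, lat_cls l -> exists X : finType, projT1 m l = cls X) /\
  (forall g, K _ _ (projT2 m g) /\ deterministic (projT2 m g)).

Lemma realizableP K (C : causal_structure) (al : obs C -> finType) P :
  realizable (C := C) (al := al) K P <->
  exists2 m : model al, valid K m & forall x, model_value m x = P x.
Proof.
split=> [[ls [E [h1 h2 h3]]]|[[ls E] [h1 h2] h3]].
  by exists (existT _ ls E).
by exists ls, E.
Qed.

Lemma eq_model (C : causal_structure) (al : obs C -> finType) (m m' : model al) :
  (forall l, projT1 m l = projT1 m' l) ->
  (forall g, box (projT2 m g) = box (projT2 m' g)) -> m = m'.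
Proof.
case: m m' => [ls E] [ls' E'] /= /funext els; case: ls' / els E' => E' eE.
congr existT; apply: functional_extensionality_dep => g.
exact: existT_inj (existT_inj (eE g)).
Qed.

Variables (C : causal_structure) (al : obs C -> finType).
Local Notation dal := (fun d => al (val d)).

Section Restrict.
Variables (r : gate C) (m : model al).
Local Notation D := (district r).

Definition restrict_lsys (d : latent D) : T := projT1 m (val d).

Lemma wsys_emb (w : wire D) :
  wsys al (projT1 m) (emb w) = wsys (C := D) dal restrict_lsys w.
Proof. by case: w. Qed.

Lemma restrict_win (g : gate D) : comps (wsys al (projT1 m)) (win (val g)) =
  comps (wsys (C := D) dal restrict_lsys) (win g).
Proof. by rewrite -emb_win; apply: comps_map => w _; apply: wsys_emb. Qed.

Lemma restrict_wout (g : gate D) : comps (wsys al (projT1 m)) (wout (val g)) =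
  comps (wsys (C := D) dal restrict_lsys) (wout g).
Proof. by rewrite -emb_wout; apply: comps_map => w _; apply: wsys_emb. Qed.

Definition restrict : model (C := D) dal :=
  existT _ restrict_lsys
    (fun g => cast_hom (restrict_win g) (restrict_wout g) (projT2 m (val g))).

Lemma box_restrict g : box (projT2 restrict g) = box (projT2 m (val g)).
Proof. exact: box_cast. Qed.

Lemma valid_restrict K : valid K m -> valid K restrict.
Proof.
case=> h1 h2; split=> [d ld|g]; first exact: h1.
apply: (@box_prop _ _ (fun A B E => K A B E /\ deterministic E)) (h2 (val g)).
exact/esym/box_restrict.
Qed.

Lemma restrict_term (k : {dffun forall l : latent C, 'I_(\dim {: V (projT1 m l)})})
    (x : {dffun forall v, al v})
    (kD : {dffun forall d : latent D, 'I_(\dim {: V (restrict_lsys d)})})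
    (xD : {dffun forall d : obs D, al (val d)}) (g : gate D) :
  (forall d, kD d = k (val d)) -> (forall d, xD d = x (val d)) ->
  cotprod (wcovec kD xD) (wout g) (projT2 restrict g (tprod (wvec kD xD) (win g))) =
  cotprod (wcovec k x) (wout (val g))
    (projT2 m (val g) (tprod (wvec k x) (win (val g)))).
Proof.
move=> hk hx; apply: box_value; first exact: box_restrict.
  rewrite -emb_win; apply/esym/boxv_tprod => -[l|v] _ /=; first by rewrite hk.
  by rewrite hx.
rewrite -emb_wout; apply/esym/boxf_cotprod => -[l|v] _ /=; first by rewrite hk.
by rewrite hx.
Qed.

End Restrict.

(* [rep] selects a gate in each district. *)
Variable rep : gate C -> gate C.
Hypothesis rep_idem : forall g, rep (rep g) = rep g.
Hypothesis rep_district : forall r g, rep r = r -> in_district r g = (rep g == r).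

Definition dindex : finType := {r : gate C | rep r == r}.

Definition drestr (r : gate C) (x : {dffun forall v, al v}) :
  {dffun forall d : obs (district r), al (val d)} := [ffun d => x (val d)].

Definition rep_index (g : gate C) : dindex :=
  exist (fun r => is_true (rep r == r)) (rep g) (introT eqP (rep_idem g)).

Lemma in_district_index (j : dindex) g : in_district (val j) g = (j == rep_index g).
Proof. by rewrite rep_district ?(eqP (valP j)) // eq_sym -val_eqE. Qed.

(** With [x] fixed, the term of a gate depends only on the latent indices of its own district, so
    [big_distr_blocks] applies once the gates are grouped by district. *)
Theorem model_value_factor (m : model al) x :
  model_value m x = \prod_(j : dindex) model_value (restrict (val j) m) (drestr (val j) x).
Proof.
rewrite /model_value /circuit_value.
pose I k := 'I_(\dim {: V (projT1 m k)}).
pose a (j : dindex) (k : {dffun forall d : {l | in_district (val j) (lsrc l)}, I (val d)}) :=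
  \prod_(g : gate (district (val j)))
    cotprod (wcovec (lsys := restrict_lsys m (r := val j)) k (drestr (val j) x)) (wout g)
     (projT2 (restrict (val j) m) g
       (tprod (wvec (lsys := restrict_lsys m (r := val j)) k (drestr (val j) x)) (win g))).
have := @big_distr_blocks R (latent C) dindex I
   (fun j l => in_district (val j) (lsrc l)) (fun l => rep_index (lsrc l))
   (fun j l => in_district_index j (lsrc l)) a.
move=> <-; apply: eq_bigr => k _; rewrite (partition_big rep_index predT) //=.
apply: eq_bigr => j _; rewrite /a.
transitivity (\prod_(g : gate (district (val j))) cotprod (wcovec k x) (wout (val g))
     (projT2 m (val g) (tprod (wvec k x) (win (val g))))).
  rewrite -(big_sub (in_district (val j)) (fun g => cotprod (wcovec k x) (wout g)
     (projT2 m g (tprod (wvec k x) (win g))))).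
  by apply: eq_bigl => g; rewrite [RHS]in_district_index eq_sym.
by apply: eq_bigr => g _; apply/esym/restrict_term => d; rewrite ffunE.
Qed.

Section Assemble.
Variable ms : forall r, model (C := district r) dal.

Lemma in_district_rep g : in_district (rep g) g.
Proof. by rewrite rep_district ?rep_idem. Qed.

Definition assemble_lsys (l : latent C) : T :=
  projT1 (ms (rep (lsrc l))) (Sub l (in_district_rep (lsrc l))).

Lemma assemble_lsysE r (d : latent (district r)) : rep r = r ->
  assemble_lsys (val d) = projT1 (ms r) d.
Proof.
move=> rr; rewrite /assemble_lsys.
(* The membership proof is generalized so that the representative in its type can be rewritten to
   [r]. *)
move: (in_district_rep (lsrc (val d))).
have -> : rep (lsrc (val d)) = r by apply/eqP; rewrite -rep_district ?(valP d).
by move=> pf; congr (projT1 (ms r) _); apply: val_inj.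
Qed.

Definition dgate_of (g : gate C) : gate (district (rep g)) :=
  Sub g (in_district_rep g).

Lemma wsys_assemble r (w : wire (district r)) : rep r = r ->
  wsys al assemble_lsys (emb w) = wsys (C := district r) dal (projT1 (ms r)) w.
Proof. by move=> rr; case: w => [l|//]; apply: assemble_lsysE. Qed.

Lemma assemble_win g :
  comps (wsys (C := district (rep g)) dal (projT1 (ms (rep g)))) (win (dgate_of g)) =
  comps (wsys al assemble_lsys) (win g).
Proof.
rewrite -[g in RHS]/(val (dgate_of g)) -emb_win; apply/esym/comps_map => w _.
by apply: wsys_assemble; apply: rep_idem.
Qed.

Lemma assemble_wout g :
  comps (wsys (C := district (rep g)) dal (projT1 (ms (rep g)))) (wout (dgate_of g)) =
  comps (wsys al assemble_lsys) (wout g).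
Proof.
rewrite -[g in RHS]/(val (dgate_of g)) -emb_wout; apply/esym/comps_map => w _.
by apply: wsys_assemble; apply: rep_idem.
Qed.

Definition assemble : model al :=
  existT _ assemble_lsys (fun g =>
    cast_hom (assemble_win g) (assemble_wout g) (projT2 (ms (rep g)) (dgate_of g))).

Lemma valid_assemble K : (forall r, valid K (ms r)) -> valid K assemble.
Proof.
move=> h; split=> [l ll|g]; first exact: (h _).1.
apply: (@box_prop _ _ (fun A B E => K A B E /\ deterministic E)) ((h _).2 (dgate_of g)).
exact/esym/box_cast.
Qed.

Lemma restrict_assemble r : rep r = r -> restrict r assemble = ms r.
Proof.
move=> rr; apply: eq_model => [d|g]; first exact: assemble_lsysE.
rewrite box_restrict /= box_cast /dgate_of.
move: (in_district_rep (val g)).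
have -> : rep (val g) = r by apply/eqP; rewrite -rep_district ?(valP g).
by case: g => g gD pf; rewrite (bool_irrelevance pf gD).
Qed.

Lemma assemble_value x :
  model_value assemble x = \prod_(j : dindex) model_value (ms (val j)) (drestr (val j) x).
Proof.
rewrite model_value_factor; apply: eq_bigr => j _.
by rewrite restrict_assemble //; apply/eqP; apply: valP j.
Qed.

End Assemble.
End Models.

(** * Models with full support *)

Section FullSupport.
Variables (R : realType) (T : gpt R).

Lemma dim_cls_unit : \dim {: V (cls unit : T)} = 1%N.
Proof.
have pt0 : (pt tt : V (cls unit : T)) != 0.
  apply/eqP => p0; have /eqP := unit_eff_pt T tt.
  by rewrite p0 !linear0 eq_sym oner_eq0.
have -> : {: V (cls unit : T)}%VS = <[pt tt]>%VS.
  apply/eqP; rewrite eqEsubv subvf andbT; apply/subvP => v _.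
  rewrite (cls_decomp v) (bigD1 tt) //= big1 => [|[]//].
  by rewrite addr0 memvZ // memv_line.
by rewrite dim_vline pt0.
Qed.

Definition uniform (X : finType) : V (cls X : T) := \sum_(x : X) #|X|%:R^-1 *: pt x.

Lemma card_neq0 (X : finType) : inhabited X -> #|X|%:R != 0 :> R.
Proof. by case=> x; rewrite pnatr_eq0 -lt0n; apply/card_gt0P; exists x. Qed.

Lemma uniform_state (X : finType) : inhabited X -> is_state (@trans R T) (uniform X).
Proof.
move=> inhX; apply: cls_state => [x|]; first by rewrite invr_ge0 ler0n.
by rewrite sumr_const -[_ *+ _]mulr_natr mulVf ?card_neq0.
Qed.

Lemma uniform_unit (X : finType) : inhabited X -> (scal (unit_eff _ (uniform X)) : R^o) = 1.
Proof.
move=> inhX; rewrite unit_eff_cls.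
under eq_bigr do rewrite clsR_sum.
by rewrite sumr_const -[_ *+ _]mulr_natr mulVf ?card_neq0.
Qed.

Variables (C : causal_structure) (al : obs C -> finType).
Hypothesis al_inh : forall v, inhabited (al v).

(** The one-point classical system is admissible for GPT and classical wires alike, and its
    dimension 1 leaves a single term in the latent sum. *)
Definition unit_lsys (l : latent C) : T := cls unit.
Local Notation ws := (wsys al unit_lsys).

Definition wuniform (w : wire C) : V (ws w) :=
  match w with inl l => uniform unit | inr v => uniform (al v) end.

Lemma wuniform_state w : is_state (@trans R T) (wuniform w).
Proof. by case: w => [l|v]; apply: uniform_state => //; exists; exact: tt. Qed.

Lemma wuniform_unit w : (scal (unit_eff _ (wuniform w)) : R^o) = 1.
Proof. by case: w => [l|v]; apply: uniform_unit => //; exists; exact: tt. Qed.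

Lemma unit_index_eq l (t t' : widx al unit_lsys (inl l)) : t = t'.
Proof.
have t0 (s : widx al unit_lsys (inl l)) : s = 0%N :> nat.
  by case: s => s /=; rewrite dim_cls_unit ltnS leqn0 => /eqP.
by apply: ord_inj; rewrite !t0.
Qed.

(* On a latent wire the uniform state is a multiple of the only basis vector. *)
Lemma latent_uniform l (t : widx al unit_lsys (inl l)) :
  (lcov t (wuniform (inl l)) : R) * scal (unit_eff _ (lvec t)) = 1.
Proof.
rewrite -[RHS](wuniform_unit (inl l)) [in RHS](lvec_lcov (wuniform (inl l))).
rewrite (big_pred1 t) => [|t']; last by rewrite (unit_index_eq t' t) /= eqxx.
by rewrite !linearZ.
Qed.

Lemma lcov_uniform_neq0 w (t : widx al unit_lsys w) : lcov t (wuniform w) != 0.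
Proof.
case: w t => [l|v] t.
  by apply: contra_eq_neq (latent_uniform t) => ->; rewrite mul0r eq_sym oner_eq0.
by rewrite lcov_obs clsR_sum invr_eq0 card_neq0.
Qed.

Lemma lvec_unit_neq0 w (t : widx al unit_lsys w) :
  (scal (unit_eff _ (lvec t)) : R^o) != 0.
Proof.
case: w t => [l|v] t; last by rewrite unit_eff_pt oner_eq0.
by apply: contra_eq_neq (latent_uniform t) => ->; rewrite mulr0 eq_sym oner_eq0.
Qed.

Lemma cotprod_tprod (S : systems R) (W : Type) (us : W -> S)
    (c : forall w, 'Hom(V (us w), R^o)) f s :
  cotprod c s (tprod f s) = \prod_(w <- s) (c w (f w) : R).
Proof.
elim: s => [|w s IHs] /=; first by rewrite scal_one big_nil.
by rewrite big_cons cotensE IHs.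
Qed.

(** Each gate discards its inputs and prepares uniform states on its outputs. *)
Lemma full_support_model :
  exists2 m : model T al, valid (@trans R T) m & forall x, 0 < model_value m x.
Proof.
have prep s : exists2 H : 'Hom(V (triv : T), V (comps ws s)),
    trans T H & H one = tprod wuniform s.
  have [|M tM ME] := @trans_insert _ T _ ws pred0 wuniform s.
    by move=> w _; apply: wuniform_state.
  by move: M tM ME; rewrite filter_pred0 => M tM ME; exists M => //; apply: (ME wuniform).
have [H tH HE] := fin_all_exists2 (fun g : gate C => prep (wout g)).
pose E (g : gate C) := (H g \o unit_eff (comps ws (win g)))%VF.
have tE g : trans T (E g) by apply: trans_comp (unit_eff_trans _) (tH g).
have EE g a : E g a = (scal (unit_eff _ a) : R) *: tprod wuniform (wout g).
  by rewrite comp_lfunE [in LHS](scal_oneP (unit_eff _ a)) linearZ /= HE.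
have dE g : deterministic (E g).
  apply/lfunP => a; rewrite comp_lfunE EE; apply: scal_inj; rewrite !linearZ /=.
  rewrite unit_eff_tprod big1 => [|w _]; last exact: wuniform_unit.
  by rewrite /GRing.scale /= mulr1.
exists (existT _ unit_lsys E).
  by split=> [l _|g]; [exists unit | split].
(* Since nonnegativity is known, it remains to exclude zero; the sign of the basis vector chosen on
   a latent wire does not matter. *)
move=> x; rewrite lt_neqAle circuit_value_ge0 // andbT eq_sym.
have [k] := latent_index dE x.
rewrite /model_value /circuit_value (big_pred1 k) => [|k']; last first.
  by apply/esym/eqP/ffunP => l; apply: (@unit_index_eq l).
apply/prodf_neq0 => g _; rewrite -(term_join E) /term EE linearZ /=.
rewrite mulf_neq0 // ?cotprod_tprod ?unit_eff_tprod.
  by rewrite prodf_seq_neq0; apply/allP => w _; apply: lvec_unit_neq0.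
by rewrite prodf_seq_neq0; apply/allP => w _; apply: lcov_uniform_neq0.
Qed.

End FullSupport.

(** * Comparing the districts of two circuits *)

(** The numbers [p i + q i - s i *+ 2] are nonnegative and sum to 0, so each vanishes; with
    [p i * q i = s i ^+ 2] this gives [(p i - s i) ^+ 2 = 0]. *)
Lemma sum_geometric_mean (R : realDomainType) (I : finType) (P : pred I) (p q s : I -> R) :
  (forall i, 0 <= p i) -> (forall i, 0 <= q i) -> (forall i, 0 <= s i) ->
  (forall i, p i * q i = s i ^+ 2) ->
  \sum_(i | P i) p i = \sum_(i | P i) s i -> \sum_(i | P i) q i = \sum_(i | P i) s i ->
  forall i, P i -> p i = s i.
Proof.
move=> p0 q0 s0 pqs sp sq.
have pos i : P i -> 0 <= p i + q i - s i *+ 2.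
  move=> _; rewrite subr_ge0 -(@ler_pXn2r _ 2) // ?nnegrE ?mulrn_wge0 ?addr_ge0 //.
  rewrite -subr_ge0 exprMn_n -pqs.
  have -> : (p i + q i) ^+ 2 - p i * q i *+ 4 = (p i - q i) ^+ 2 by ring.
  exact: sqr_ge0.
have sum0 : \sum_(i | P i) (p i + q i - s i *+ 2) = 0.
  by rewrite sumrB big_split /= sp sq sumrMnl mulr2n subrr.
move=> i Pi; have /eqP := psumr_eq0P pos sum0 Pi; rewrite subr_eq0 => /eqP e.
have : (p i - s i) ^+ 2 = 0.
  have qE : q i = s i *+ 2 - p i by rewrite -e addrAC subrr add0r.
  have -> : (p i - s i) ^+ 2 = s i ^+ 2 - p i * (s i *+ 2 - p i) by ring.
  by rewrite -qE pqs subrr.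
by move/eqP; rewrite sqrf_eq0 subr_eq0 => /eqP.
Qed.

(** * Representatives of districts and extension of alphabets *)

Section Representatives.
Variable C : causal_structure.

Lemma latent_adj_sym : connect_sym (@latent_adj C).
Proof. by apply: sym_connect_sym => g h; apply: eq_existsb => l; rewrite orbC. Qed.

Lemma root_district (r g : gate C) : fingraph.root (@latent_adj C) r = r ->
  in_district r g = (fingraph.root (@latent_adj C) g == r).
Proof.
by move=> rr; rewrite eq_sym -[in RHS]rr (root_connect latent_adj_sym).
Qed.

(** The roots of the components are used, except that [g0] represents its own district, so that
    [district g0] itself occurs among the factors. *)
Lemma district_rep (g0 : gate C) : exists rep : gate C -> gate C,
  [/\ rep g0 = g0, forall g, rep (rep g) = rep g
    & forall r g, rep r = r -> in_district r g = (rep g == r)].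
Proof.
pose rt := fingraph.root (@latent_adj C); have sym := latent_adj_sym.
have rtE g h : (rt g == rt h) = connect (@latent_adj C) g h := root_connect sym g h.
pose rep g := if connect (@latent_adj C) g0 g then g0 else rt g.
have rep_root g : rt (rep g) = rt g.
  rewrite /rep; case: ifP => [gg|_]; first by apply/eqP; rewrite rtE.
  exact: root_root.
have repE g h : rt g = rt h -> rep g = rep h.
  by move=> gh; rewrite /rep -!rtE gh.
exists rep; split=> [|g|r g rr]; first by rewrite /rep connect0.
  exact/repE/rep_root.
rewrite /in_district -rtE; apply/eqP/eqP => [/repE <- //|<-].
by rewrite rep_root.
Qed.

End Representatives.

Section Extension.
Variables (I : finType) (p : pred I).

(** Elements outside [p] get a one-point alphabet. The equality of functions allows [a] to be
    eliminated in favour of [b]. *)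
Lemma alphabet_extension (a : {i | p i} -> finType) : (forall d, inhabited (a d)) ->
  exists2 b : I -> finType, (forall i, inhabited (b i)) & (fun d => b (val d)) = a.
Proof.
move=> inh; exists (fun i => if insub i is Some d then a d else unit : finType).
  by move=> i; case: insub => [d|]; [exact: inh | exists; exact: tt].
by apply: funext => d; rewrite valK.
Qed.

Lemma dffun_extension (b : I -> finType) (inh : forall i, inhabited (b i))
    (y : {dffun forall d : {i | p i}, b (val d)}) :
  exists x : {dffun forall i, b i}, [ffun d => x (val d)] = y.
Proof.
(* The transport makes the value of [y] at [d] an element of [b i]; as membership proofs are
   irrelevant, at most one [d] lies over [i]. *)
have ex i : exists t : b i, forall d (e : val d = i), ecast i (b i) e (y d) = t.
  have [pi|npi] := boolP (p i).
    exists (y (exist _ i pi)) => -[j pj] /= e; case: i / e pi => pi.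
    by rewrite (bool_irrelevance pi pj).
  have [t] := inh i; exists t => -[j pj] /= e.
  by rewrite -e pj in npi.
have [x xE] := fin_all_exists ex.
exists (finfun x); apply/ffunP => d; rewrite !ffunE.
by rewrite -(xE _ d erefl).
Qed.

End Extension.

(** * The two implications between gaps *)

Lemma valid_swirled (R : realType) (T : gpt R) (G : finGroupType) (F : symmetry T G)
    (C : causal_structure) (al : obs C -> finType) (m : model T al) :
  valid (@swirled R T G F) m -> valid (@trans R T) m.
Proof. by case=> h1 h2; split=> // g; have [[]] := h2 g. Qed.

Lemma realizable_swirled (R : realType) (T : gpt R) (G : finGroupType)
    (F : symmetry T G) (C : causal_structure) (al : obs C -> finType) P :
  realizable (C := C) (al := al) (@swirled R T G F) P ->
  realizable (@trans R T) P.
Proof. by case/realizableP=> m /valid_swirled vm mP; apply/realizableP; exists m. Qed.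

Lemma district_gap (R : realType) (T : gpt R) (G : finGroupType) (F : symmetry T G)
    (C : causal_structure) :
  admits_gap F C -> exists g : gate C, admits_gap F (district g).
Proof.
case=> al inh [_ [P /realizableP[m vm mP] nP]]; apply: contrapT => no_gap.
have [r|ms vms msE] := @fin_all_exists2 (gate C)
    (fun r => model T (C := district r) (fun d => al (val d)))
    (fun r mr => valid (@swirled R T G F) mr)
    (fun r mr => forall x, model_value mr x = model_value (restrict r m) x).
  apply/(realizableP (@swirled R T G F)).
  (* If no swirled model had these values, [restrict r m] would witness a gap in the district of
     [r]. *)
  apply: contrapT => nr; apply: no_gap; exists r.
  exists (fun d => al (val d)) => //; split; first by move=> Q; apply: realizable_swirled.
  exists (model_value (restrict r m)) => //; apply/realizableP.
  by exists (restrict r m) => //; apply: valid_restrict.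
have idem (g : gate C) := root_root (@latent_adj_sym C) g.
apply: nP; apply/realizableP.
exists (assemble idem (@root_district C) ms); first exact: valid_assemble.
move=> x; rewrite -mP assemble_value (model_value_factor idem (@root_district C)).
by apply: eq_bigr => j _; rewrite msE.
Qed.

Lemma gap_of_district (R : realType) (T : gpt R) (G : finGroupType) (F : symmetry T G)
    (C : causal_structure) (g0 : gate C) :
  admits_gap F (district g0) -> admits_gap F C.
Proof.
case=> alD inhD [_ [P PT nP]].
have [al inh eal] := alphabet_extension inhD.
case: _ / eal P PT nP inhD => P /realizableP[m0 vm0 m0P] nP _.
exists al => //; split; first by move=> Q; apply: realizable_swirled.
have [rep [rep0 idem repD]] := district_rep g0.
pose dm r := model T (C := district r) (fun d => al (val d)).
pose upd (a : dm g0) (b : forall r, dm r) r : dm r :=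
  if pselect (g0 = r) is left e then ecast r (dm r) e a else b r.
have upd_eq a b : upd a b g0 = a.
  by rewrite /upd; case: pselect => // e; rewrite (Prop_irrelevance e erefl).
have upd_neq a b r : g0 <> r -> upd a b r = b r.
  by rewrite /upd; case: pselect.
pose asm := assemble (T := T) (al := al) idem repD.
pose j0 : dindex rep := exist (fun r => is_true (rep r == r)) g0 (introT eqP rep0).
pose rest (b : forall r, dm r) x :=
  \prod_(j : dindex rep | j != j0) model_value (b (val j)) (drestr (val j) x).
have asmE a b x : model_value (asm (upd a b)) x =
    model_value a (drestr g0 x) * rest b x.
  rewrite assemble_value (bigD1 j0) //= upd_eq; congr (_ * _).
  apply: eq_bigr => j jj0; rewrite upd_neq // => e.
  by case/eqP: jj0; apply: val_inj; rewrite /= -e.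
have asm_valid a b : valid (@trans R T) a -> (forall r, valid (@trans R T) (b r)) ->
    valid (@trans R T) (asm (upd a b)).
  move=> va vb; apply: valid_assemble => r; rewrite /upd.
  by case: pselect => // e; case: r / e.
have [u uT u0] := fin_all_exists2 (fun r : gate C =>
  @full_support_model R T (district r) (fun d => al (val d)) (fun d => inh (val d))).
exists (model_value (asm (upd m0 u))).
  by apply/realizableP; exists (asm (upd m0 u)) => //; apply: asm_valid.
case/realizableP=> m' vm' m'E; apply: nP; apply/realizableP.
have vm'T := valid_swirled vm'.
pose b r := restrict r m'.
exists (b g0) => [|y]; first exact: valid_restrict.
have [x xy] := dffun_extension inh y.
rewrite -m0P -xy -/(drestr g0 x).
have m'F x' : model_value m' x' = model_value (b g0) (drestr g0 x') * rest b x'.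
  by rewrite (model_value_factor idem repD) (bigD1 j0).
have vb r : valid (@trans R T) (b r) by apply: valid_restrict.
have ge0 (m : model T al) : valid (@trans R T) m -> forall x, 0 <= model_value m x.
  by move=> [_ vm] x'; apply: circuit_value_ge0 => g; apply: (vm g).1.
have sum1 (m : model T al) : valid (@trans R T) m ->
    \sum_(x' | agree (fun v => osrc v != None) x x') model_value m x' = 1.
  by move=> [_ vm]; apply: circuit_value_sum => g; apply: (vm g).2.
have va1 := asm_valid _ _ vm0 vb; have va2 := asm_valid _ _ (vb g0) uT.
(* The mixed models exchange the factor of [g0] between the swirled model [m'] and the model glued
   from [m0] and [u], which have equal values by [m'E]. *)
have prodE x' : model_value (asm (upd (b g0) u)) x' * model_value (asm (upd m0 b)) x' =
    model_value m' x' ^+ 2.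
  by rewrite expr2 {1}m'E m'F !asmE; ring.
(* Only points with the open inputs of [x] are summed over, as total mass 1 holds for each choice of
   them. *)
have := sum_geometric_mean (ge0 _ va2) (ge0 _ va1) (ge0 _ vm'T) prodE
  (etrans (sum1 _ va2) (esym (sum1 _ vm'T))) (etrans (sum1 _ va1) (esym (sum1 _ vm'T)))
  (agree_refl _ x).
(* Both sides share the factor [rest u x], which full support makes nonzero, so it cancels. *)
rewrite m'E !asmE => /mulIf; apply.
by apply/prodf_neq0 => j _; rewrite gt_eqF // u0.
Qed.

Theorem proposition1 (R : realType) (T : gpt R) (G : finGroupType)
    (F : symmetry T G) (hF : nonphysical F) (C : causal_structure) :
  admits_gap F C <-> exists g : gate C, admits_gap F (district g).
Proof. by split=> [/district_gap//|[g /gap_of_district]]. Qed.
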